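(* Let $$L(z)=L_{gl_n[t]}(z)=\sum_{i=1}^{\infty}\frac{1}{z^{i}}\begin{pmatrix} e_{1,1}t^{i-1}&\dots&e_{1,n}t^{i-1}\\ \vdots&&\vdots\\ e_{n,1}t^{i-1}&\dots&e_{n,n}t^{i-1}\end{pmatrix}\in \mathrm{Mat}_n\otimes U(gl_n[t])\otimes\mathbb C((z^{-1})),$$ and for $k\ge1$ write $\mathrm{Tr}\,S^k(\partial_z-L(z))=\sum_{j=0}^{k}c_{j,k}(z)\partial_z^j$ and $S_k(z):=(-1)^kc_{0,k}(z)$. Then the $S_k(z)$ are generating functions in the variable $z$ of elements of the commutative Bethe subalgebra of $U(gl_n[t])$. Such elements for $k=1,\dots,n$ algebraically generate the Bethe subalgebra.
   Context: $e_{ij}$ is the standard basis of $gl_n$, $gl_n[t]$ the polynomial current Lie algebra over $\mathbb C$, $U(\cdot)$ the universal enveloping algebra; $\partial_z$ satisfies $[\partial_z,f(z)]=f'(z)$. The Bethe subalgebra of $U(gl_n[t])$ is the commutative subalgebra generated by all coefficients (in $z$) of the series $QH_i(z)$, $i=0,\dots,n$, defined by $\det^{col}(\partial_z-L_{gl_n[t]}(z))=\sum_{i=0}^n QH_i(z)\partial_z^i$, where $\det^{col}N=\sum_{\sigma\in S_n}(-1)^\sigma N_{\sigma(1),1}\cdots N_{\sigma(n),n}$. For an $n\times n$ matrix $M$ with noncommuting entries, $$\mathrm{Tr}\,S^kM:=\frac1{k!}\sum_{1\le l_1,\dots,l_k\le n}\ \mathrm{perm}^{row}\bigl(M_{l_a,l_b}\bigr)_{a,b=1}^{k},\qquad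 \mathrm{perm}^{row}N=\sum_{\sigma\in S_k}N_{1,\sigma(1)}\cdots N_{k,\sigma(k)} .$$ *)

(* Defs.v *)
From HB Require Import structures.
From mathcomp Require Import all_boot all_order all_fingroup all_algebra.
From mathcomp Require Import ring generic_quotient.
From mathcomp Require Import boolp classical_sets reals complex.

Set Implicit Arguments.
Unset Strict Implicit.
Unset Printing Implicit Defensive.
Import GRing.Theory.

Local Open Scope ring_scope.
Local Open Scope quotient_scope.

HB.mixin Record Lmodule_isLieAlgebra (K : comNzRingType) g
    of GRing.Lmodule K g := {
  lie : g -> g -> g;
  lie_linearl : forall a x y z, lie (a *: x + y) z = a *: lie x z + lie y z;
  lie_linearr : forall a x y z, lie z (a *: x + y) = a *: lie z x + lie z y;
  lie_alternating : forall x, lie x x = 0;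
  lie_jacobi : forall x y z,
    lie x (lie y z) + lie y (lie z x) + lie z (lie x y) = 0
}.

#[short(type="lieAlgType")]
HB.structure Definition LieAlgebra (K : comNzRingType) :=
  {g of Lmodule_isLieAlgebra K g & GRing.Lmodule K g}.

(* The universal enveloping algebra of g, presented by generators and
   relations: noncommutative polynomial expressions in the elements of g,
   modulo the congruence generated by the K-algebra axioms, the linearity of
   g -> U(g), and x y - y x = [x, y]. Negation is multiplication by -1. *)
Section UniversalEnvelopingAlgebra.
Variables (K : comNzRingType) (g : lieAlgType K).

Inductive uea_expr : Type :=
  | UCst of K
  | UGen of g
  | UAdd of uea_expr & uea_expr
  | UMul of uea_expr & uea_expr.

Inductive uea_rel : uea_expr -> uea_expr -> Prop :=
  | urel_refl x : uea_rel x x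
  | urel_sym x y : uea_rel x y -> uea_rel y x
  | urel_trans x y z : uea_rel x y -> uea_rel y z -> uea_rel x z
  | urel_add x x' y y' :
      uea_rel x x' -> uea_rel y y' -> uea_rel (UAdd x y) (UAdd x' y')
  | urel_mul x x' y y' :
      uea_rel x x' -> uea_rel y y' -> uea_rel (UMul x y) (UMul x' y')
  | urel_addA x y z : uea_rel (UAdd x (UAdd y z)) (UAdd (UAdd x y) z)
  | urel_addC x y : uea_rel (UAdd x y) (UAdd y x)
  | urel_add0 x : uea_rel (UAdd (UCst 0) x) x
  | urel_addN x : uea_rel (UAdd (UMul (UCst (-1)) x) x) (UCst 0)
  | urel_mulA x y z : uea_rel (UMul x (UMul y z)) (UMul (UMul x y) z)
  | urel_mul1l x : uea_rel (UMul (UCst 1) x) x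
  | urel_mulDl x y z :
      uea_rel (UMul (UAdd x y) z) (UAdd (UMul x z) (UMul y z))
  | urel_mulDr x y z :
      uea_rel (UMul z (UAdd x y)) (UAdd (UMul z x) (UMul z y))
  | urel_cstD a b : uea_rel (UCst (a + b)) (UAdd (UCst a) (UCst b))
  | urel_cstM a b : uea_rel (UCst (a * b)) (UMul (UCst a) (UCst b))
  | urel_cstC a x : uea_rel (UMul (UCst a) x) (UMul x (UCst a))
  | urel_genD x y : uea_rel (UGen (x + y)) (UAdd (UGen x) (UGen y))
  | urel_genZ a x : uea_rel (UGen (a *: x)) (UMul (UCst a) (UGen x))
  | urel_lie x y :
      uea_rel (UMul (UGen x) (UGen y))
              (UAdd (UMul (UGen y) (UGen x)) (UGen (lie x y))).

HB.instance Definition _ := gen_eqMixin uea_expr.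
HB.instance Definition _ := gen_choiceMixin uea_expr.

Definition uea_relb (x y : uea_expr) : bool := `[< uea_rel x y >].

Lemma uea_relb_equiv : equiv_class_of uea_relb.
Proof.
split=> [x|x y|y x z].
- exact/asboolP/urel_refl.
- by apply/asbool_equiv_eq; split; apply: urel_sym.
- by move=> /asboolP xy /asboolP yz; apply/asboolP; apply: urel_trans xy yz.
Qed.

Canonical uea_equiv := EquivRelPack uea_relb_equiv.

Definition uea : Type := {eq_quot uea_equiv}.

HB.instance Definition _ := Choice.on uea.
HB.instance Definition _ := EqQuotient.on uea.

Definition uea_class (x : uea_expr) : uea := \pi_uea x.

Lemma uea_classP x y : uea_class x = uea_class y <-> uea_rel x y.
Proof. by split=> [/eqquotP/asboolP //|xy]; apply/eqquotP/asboolP. Qed.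

Lemma uea_reprK (u : uea) : uea_class (repr u) = u.
Proof. exact: reprK. Qed.

Lemma repr_uea_class x : uea_rel (repr (uea_class x)) x.
Proof. by apply/uea_classP; rewrite uea_reprK. Qed.

Definition uea_zero : uea := uea_class (UCst 0).
Definition uea_one : uea := uea_class (UCst 1).
Definition uea_add (u v : uea) : uea := uea_class (UAdd (repr u) (repr v)).
Definition uea_mul (u v : uea) : uea := uea_class (UMul (repr u) (repr v)).
Definition uea_opp (u : uea) : uea := uea_class (UMul (UCst (-1)) (repr u)).
Definition uea_scale (a : K) (u : uea) : uea :=
  uea_class (UMul (UCst a) (repr u)).

Lemma uea_addE x y :
  uea_add (uea_class x) (uea_class y) = uea_class (UAdd x y).
Proof. by apply/uea_classP/urel_add; apply: repr_uea_class. Qed.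

Lemma uea_mulE x y :
  uea_mul (uea_class x) (uea_class y) = uea_class (UMul x y).
Proof. by apply/uea_classP/urel_mul; apply: repr_uea_class. Qed.

Lemma uea_oppE x : uea_opp (uea_class x) = uea_class (UMul (UCst (-1)) x).
Proof.
by apply/uea_classP/urel_mul; [apply: urel_refl | apply: repr_uea_class].
Qed.

Lemma uea_scaleE a x : uea_scale a (uea_class x) = uea_class (UMul (UCst a) x).
Proof.
by apply/uea_classP/urel_mul; [apply: urel_refl | apply: repr_uea_class].
Qed.

Lemma ueaP (P : uea -> Prop) : (forall x, P (uea_class x)) -> forall u, P u.
Proof. by move=> Px u; rewrite -[u]uea_reprK. Qed.

Let ueaE := (uea_addE, uea_mulE, uea_oppE, uea_scaleE).

Fact uea_addA : associative uea_add.
Proof.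
by do 3!elim/ueaP=> ?; rewrite !ueaE; apply/uea_classP; apply: urel_addA.
Qed.

Fact uea_addC : commutative uea_add.
Proof.
by do 2!elim/ueaP=> ?; rewrite !ueaE; apply/uea_classP; apply: urel_addC.
Qed.

Fact uea_add0 : left_id uea_zero uea_add.
Proof. by elim/ueaP=> ?; rewrite !ueaE; apply/uea_classP; apply: urel_add0. Qed.

Fact uea_addN : left_inverse uea_zero uea_opp uea_add.
Proof. by elim/ueaP=> ?; rewrite !ueaE; apply/uea_classP; apply: urel_addN. Qed.

HB.instance Definition _ :=
  GRing.isZmodule.Build uea uea_addA uea_addC uea_add0 uea_addN.

Fact uea_mulA : associative uea_mul.
Proof.
by do 3!elim/ueaP=> ?; rewrite !ueaE; apply/uea_classP; apply: urel_mulA.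
Qed.

Fact uea_mul1l : left_id uea_one uea_mul.
Proof.
by elim/ueaP=> ?; rewrite !ueaE; apply/uea_classP; apply: urel_mul1l.
Qed.

Fact uea_mul1r : right_id uea_one uea_mul.
Proof.
elim/ueaP=> x; rewrite !ueaE; apply/uea_classP.
by apply: urel_trans (urel_sym (urel_cstC 1 x)) (urel_mul1l x).
Qed.

Fact uea_mulDl : left_distributive uea_mul uea_add.
Proof.
by do 3!elim/ueaP=> ?; rewrite !ueaE; apply/uea_classP; apply: urel_mulDl.
Qed.

Fact uea_mulDr : right_distributive uea_mul uea_add.
Proof.
by do 3!elim/ueaP=> ?; rewrite !ueaE; apply/uea_classP; apply: urel_mulDr.
Qed.

Fixpoint uea_eval (A : algType K) (f : g -> A) (x : uea_expr) : A :=
  match x with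
  | UCst a => a%:A
  | UGen y => f y
  | UAdd y z => uea_eval f y + uea_eval f z
  | UMul y z => uea_eval f y * uea_eval f z
  end.

Lemma uea_eval_rel (A : algType K) (f : g -> A) :
    (forall a x y, f (a *: x + y) = a *: f x + f y) ->
    (forall x y, f (lie x y) = f x * f y - f y * f x) ->
  forall x y, uea_rel x y -> uea_eval f x = uea_eval f y.
Proof.
move=> flin flie x y.
have f0 : f 0 = 0.
  have := flin (-1) 0 0.
  by rewrite scaler0 addr0 scaleN1r addNr.
elim=> //=; do ?by move=> *; congruence.
- by move=> *; rewrite addrA.
- by move=> *; rewrite addrC.
- by move=> *; rewrite scale0r add0r.
- by move=> z; rewrite scaleN1r mulN1r addNr scale0r.
- by move=> *; rewrite mulrA.
- by move=> *; rewrite scale1r mul1r.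
- by move=> *; rewrite mulrDl.
- by move=> *; rewrite mulrDr.
- by move=> *; rewrite scalerDl.
- by move=> *; rewrite -scalerAl mul1r scalerA.
- by move=> *; rewrite -scalerAl -scalerAr mul1r mulr1.
- by move=> z t; rewrite -[z in LHS]scale1r flin scale1r.
- by move=> a z; rewrite -[a *: z]addr0 flin f0 addr0 -scalerAl mul1r.
- by move=> z t; rewrite flie addrC subrK.
Qed.

Fact uea_one_neq0 : uea_one != 0.
Proof.
apply/eqP => /uea_classP /(@uea_eval_rel K^o (fun=> 0)) /=.
rewrite scale1r scale0r => h.
suff /eqP : (1 : K) = 0 by rewrite oner_eq0.
by apply: h => *; rewrite ?scaler0 ?addr0 // mulr0 subr0.
Qed.

HB.instance Definition _ := GRing.Zmodule_isNzRing.Build uea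
  uea_mulA uea_mul1l uea_mul1r uea_mulDl uea_mulDr uea_one_neq0.

Fact uea_scaleA a b u : uea_scale a (uea_scale b u) = uea_scale (a * b) u.
Proof.
elim/ueaP: u => x; rewrite !ueaE; apply/uea_classP.
apply: urel_trans (urel_mulA _ _ _) _.
by apply: urel_mul (urel_refl _); apply/urel_sym/urel_cstM.
Qed.

Fact uea_scale1 : left_id 1 uea_scale.
Proof.
by elim/ueaP=> ?; rewrite !ueaE; apply/uea_classP; apply: urel_mul1l.
Qed.

Fact uea_scaleDr : right_distributive uea_scale +%R.
Proof.
by move=> a; do 2!elim/ueaP=> ?; rewrite /GRing.add /= !ueaE; apply/uea_classP;
  apply: urel_mulDr.
Qed.

Fact uea_scaleDl u : {morph uea_scale^~ u : a b / a + b}.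
Proof.
move=> a b; elim/ueaP: u => x; rewrite [RHS]/GRing.add /= !ueaE.
apply/uea_classP; apply: urel_trans (urel_mulDl _ _ _).
by apply: urel_mul (urel_refl _); apply: urel_cstD.
Qed.

HB.instance Definition _ := GRing.Zmodule_isLmodule.Build K uea
  uea_scaleA uea_scale1 uea_scaleDr uea_scaleDl.

Fact uea_scaleAl (a : K) (u v : uea) : a *: (u * v) = (a *: u) * v.
Proof.
move: u v; do 2!elim/ueaP=> ?.
by rewrite /GRing.mul /GRing.scale /= !ueaE; apply/uea_classP/urel_mulA.
Qed.

HB.instance Definition _ := GRing.Lmodule_isLalgebra.Build K uea uea_scaleAl.

Fact uea_scaleAr (a : K) (u v : uea) : a *: (u * v) = u * (a *: v).
Proof.
move: u v; elim/ueaP=> x; elim/ueaP=> y.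
rewrite /GRing.mul /GRing.scale /= !ueaE; apply/uea_classP.
apply: urel_trans (urel_mulA _ _ _) _.
apply: urel_trans (urel_sym (urel_mulA _ _ _)).
by apply: urel_mul (urel_refl _); apply: urel_cstC.
Qed.

HB.instance Definition _ := GRing.Lalgebra_isAlgebra.Build K uea uea_scaleAr.

Definition uea_gen (x : g) : uea := uea_class (UGen x).

Fact uea_gen_linear : linear uea_gen.
Proof.
move=> a x y.
have -> : a *: uea_gen x = uea_class (UMul (UCst a) (UGen x)).
  exact: uea_scaleE.
rewrite [RHS]/GRing.add /= ueaE; apply/uea_classP/(urel_trans (urel_genD _ _)).
by apply: urel_add (urel_refl _); apply: urel_genZ.
Qed.

HB.instance Definition _ := GRing.isLinear.Build K g uea _ uea_gen
  uea_gen_linear.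

Lemma uea_gen_lie x y :
  uea_gen (lie x y) = uea_gen x * uea_gen y - uea_gen y * uea_gen x.
Proof.
have mE u v : uea_gen u * uea_gen v = uea_class (UMul (UGen u) (UGen v)).
  exact: uea_mulE.
apply: (addIr (uea_gen y * uea_gen x)); rewrite subrK addrC !mE.
by rewrite [LHS]uea_addE; apply/uea_classP/urel_sym/urel_lie.
Qed.

Lemma uea_universal (A : algType K) (f : {linear g -> A}) :
    (forall x y, f (lie x y) = f x * f y - f y * f x) ->
  exists h : {lrmorphism uea -> A},
    (forall x, h (uea_gen x) = f x) /\
    (forall h' : {lrmorphism uea -> A},
       (forall x, h' (uea_gen x) = f x) -> h' =1 h).
Proof.
move=> flie.
have frel := uea_eval_rel (linearP f) flie.
pose h (u : uea) := uea_eval f (repr u).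
have hE x : h (uea_class x) = uea_eval f x by apply/frel/repr_uea_class.
have hlin : linear h.
  move=> a; elim/ueaP=> x; elim/ueaP=> y.
  rewrite [in LHS]/GRing.add [in LHS]/GRing.scale /= !ueaE !hE /=.
  by rewrite -scalerAl mul1r.
have hmul : monoid_morphism h.
  split=> [|]; first by rewrite [1]/(uea_class (UCst 1)) hE /= scale1r.
  elim/ueaP=> x; elim/ueaP=> y.
  by rewrite [in LHS]/GRing.mul /= !ueaE !hE.
pose hL := GRing.isLinear.Build K uea A _ h hlin.
pose hM := GRing.isMonoidMorphism.Build uea A h hmul.
pose H : {lrmorphism uea -> A} := HB.pack h hL hM.
exists H; split=> [x|h' h'E]; first exact: hE.
elim/ueaP=> x; rewrite [RHS]hE; elim: x => [a|x|x IHx y IHy|x IHx y IHy] /=.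
- have -> : uea_class (UCst a) = a%:A.
    rewrite /GRing.scale /= ueaE; apply/uea_classP.
    apply: urel_trans (urel_cstM _ _).
    by rewrite mulr1; apply: urel_refl.
  by rewrite linearZ /= rmorph1.
- exact: h'E.
- by rewrite -IHx -IHy -rmorphD /= [in RHS]/GRing.add /= ueaE.
- by rewrite -IHx -IHy -rmorphM /= [in RHS]/GRing.mul /= ueaE.
Qed.

End UniversalEnvelopingAlgebra.

(* The current algebra gl_n[t], seen as gl_n(K[t]): the matrix unit e_ij times
   t^r is 'X^r *: delta_mx i j. *)
Section CurrentAlgebra.
Variables (K : comNzRingType) (n : nat).

Definition gl_current : Type := 'M[{poly K}]_n.

HB.instance Definition _ := GRing.Zmodule.on gl_current.

Definition gl_current_scale (a : K) (x : gl_current) : gl_current :=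
  (a%:P : {poly K}) *: (x : 'M[{poly K}]_n).

Fact gl_current_scaleA a b x :
  gl_current_scale a (gl_current_scale b x) = gl_current_scale (a * b) x.
Proof. by rewrite /gl_current_scale scalerA polyCM. Qed.

Fact gl_current_scale1 : left_id 1 gl_current_scale.
Proof. by move=> x; rewrite /gl_current_scale scale1r. Qed.

Fact gl_current_scaleDr : right_distributive gl_current_scale +%R.
Proof. by move=> a x y; rewrite /gl_current_scale scalerDr. Qed.

Fact gl_current_scaleDl x : {morph gl_current_scale^~ x : a b / a + b}.
Proof. by move=> a b; rewrite /gl_current_scale polyCD scalerDl. Qed.

HB.instance Definition _ := GRing.Zmodule_isLmodule.Build K gl_current
  gl_current_scaleA gl_current_scale1 gl_current_scaleDr gl_current_scaleDl.

Definition gl_bracket (x y : gl_current) : gl_current := x *m y - y *m x.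

Fact gl_bracket_linearl a x y z :
  gl_bracket (a *: x + y) z = a *: gl_bracket x z + gl_bracket y z.
Proof.
rewrite /gl_bracket ![_ *: _]/(gl_current_scale _ _) /gl_current_scale.
rewrite mulmxDl mulmxDr -scalemxAl -scalemxAr scalerBr opprD.
by rewrite addrACA.
Qed.

Fact gl_bracket_linearr a x y z :
  gl_bracket z (a *: x + y) = a *: gl_bracket z x + gl_bracket z y.
Proof.
rewrite /gl_bracket ![_ *: _]/(gl_current_scale _ _) /gl_current_scale.
rewrite mulmxDl mulmxDr -scalemxAl -scalemxAr scalerBr opprD.
by rewrite addrACA.
Qed.

Fact gl_bracket_alternating x : gl_bracket x x = 0.
Proof. exact: subrr. Qed.

Fact gl_bracket_jacobi x y z :
  gl_bracket x (gl_bracket y z) + gl_bracket y (gl_bracket z x)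
    + gl_bracket z (gl_bracket x y) = 0.
Proof.
rewrite /gl_bracket !(mulmxBl, mulmxBr) !mulmxA.
set a := x *m y *m z; set b := x *m z *m y; set c := y *m z *m x.
set d := y *m x *m z; set e := z *m x *m y; set f := z *m y *m x.
rewrite !opprB; apply/matrixP => i j; rewrite !mxE.
ring.
Qed.

HB.instance Definition _ := Lmodule_isLieAlgebra.Build K gl_current
  gl_bracket_linearl gl_bracket_linearr gl_bracket_alternating
  gl_bracket_jacobi.

End CurrentAlgebra.

(* The formal power series in 1/z over a ring A, as a subring of the Laurent
   series A((1/z)): [zcoef f m] is the coefficient of z^-m. All the series
   considered here have no positive power of z, and this subring is stable
   under d/dz. *)
Record zseries (A : Type) := ZSeries { zcoef : nat -> A }.

Section SeriesRing.
Variable A : nzRingType.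
Implicit Types f g h : zseries A.

HB.instance Definition _ := gen_eqMixin (zseries A).
HB.instance Definition _ := gen_choiceMixin (zseries A).

Lemma zseriesP f g : zcoef f =1 zcoef g -> f = g.
Proof. by case: f g => f [g] /funext /= ->. Qed.

Definition zs_add f g := ZSeries (fun m => zcoef f m + zcoef g m).
Definition zs_opp f := ZSeries (fun m => - zcoef f m).
Definition zs_const (a : A) := ZSeries (fun m => if m == 0%N then a else 0).
Definition zs_mul f g :=
  ZSeries (fun m => \sum_(i < m.+1) zcoef f i * zcoef g (m - i)).

(* d/dz (z^-m) = - m z^-(m+1); the coefficient of z^0 vanishes as 0.-1 = 0 *)
Definition zs_deriv f := ZSeries (fun m => - (zcoef f m.-1 *+ m.-1)).

Fact zs_addA : associative zs_add.
Proof. by move=> f g h; apply: zseriesP => m /=; rewrite addrA. Qed.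

Fact zs_addC : commutative zs_add.
Proof. by move=> f g; apply: zseriesP => m /=; rewrite addrC. Qed.

Fact zs_add0 : left_id (zs_const 0) zs_add.
Proof. by move=> f; apply: zseriesP => m /=; rewrite if_same add0r. Qed.

Fact zs_addN : left_inverse (zs_const 0) zs_opp zs_add.
Proof. by move=> f; apply: zseriesP => m /=; rewrite if_same addNr. Qed.

HB.instance Definition _ :=
  GRing.isZmodule.Build (zseries A) zs_addA zs_addC zs_add0 zs_addN.

Lemma zcoef0 m : zcoef (0 : zseries A) m = 0.
Proof. by rewrite /= if_same. Qed.

Lemma zcoefD f g m : zcoef (f + g) m = zcoef f m + zcoef g m.
Proof. by []. Qed.

Let trunc N f : {poly A} := \poly_(i < N) zcoef f i.

Let truncM N f g m : (m < N)%N ->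
  zcoef (zs_mul f g) m = (trunc N f * trunc N g)`_m.
Proof.
move=> mN; rewrite coefM; apply: eq_bigr => i _; rewrite !coef_poly.
have iN : (i < N)%N by apply: leq_trans (ltn_ord i) mN.
by rewrite iN (leq_ltn_trans (leq_subr _ _) mN).
Qed.

Fact zs_mulA : associative zs_mul.
Proof.
move=> f g h; apply: zseriesP => m.
transitivity (trunc m.+1 f * (trunc m.+1 g * trunc m.+1 h))`_m.
  rewrite coefM; apply: eq_bigr => i _.
  by rewrite (@truncM m.+1) ?ltnS ?leq_subr // coef_poly ltn_ord.
rewrite mulrA coefM; apply: eq_bigr => i _.
by rewrite (@truncM m.+1) // coef_poly ltnS leq_subr.
Qed.

Fact zs_mul1l : left_id (zs_const 1) zs_mul.
Proof.
move=> f; apply: zseriesP => m /=.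
rewrite big_ord_recl /= mul1r subn0 big1 ?addr0 // => i _.
by rewrite mul0r.
Qed.

Fact zs_mul1r : right_id (zs_const 1) zs_mul.
Proof.
move=> f; apply: zseriesP => m /=.
rewrite big_ord_recr /= subnn mulr1 big1 ?add0r // => i _.
by rewrite subn_eq0 leqNgt ltn_ord mulr0.
Qed.

Fact zs_mulDl : left_distributive zs_mul zs_add.
Proof.
move=> f g h; apply: zseriesP => m /=.
by rewrite -big_split; apply: eq_bigr => i _; rewrite mulrDl.
Qed.

Fact zs_mulDr : right_distributive zs_mul zs_add.
Proof.
move=> f g h; apply: zseriesP => m /=.
by rewrite -big_split; apply: eq_bigr => i _; rewrite mulrDr.
Qed.

Fact zs_one_neq0 : zs_const 1 != 0.
Proof.
apply/eqP => /(congr1 (fun f => zcoef f 0)) /= /eqP.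
by rewrite oner_eq0.
Qed.

HB.instance Definition _ := GRing.Zmodule_isNzRing.Build (zseries A)
  zs_mulA zs_mul1l zs_mul1r zs_mulDl zs_mulDr zs_one_neq0.

Fact zs_deriv_zmod_morphism : zmod_morphism zs_deriv.
Proof.
by move=> f g; apply: zseriesP => m /=; rewrite mulrnBl opprD.
Qed.

HB.instance Definition _ := GRing.isZmodMorphism.Build _ _ zs_deriv
  zs_deriv_zmod_morphism.

Lemma zs_derivM f g : zs_deriv (f * g) = zs_deriv f * g + f * zs_deriv g.
Proof.
apply: zseriesP => m; rewrite zcoefD.
have zM u v : zcoef (u * v) m = \sum_(i < m.+1) zcoef u i * zcoef v (m - i).
  by [].
rewrite !zM big_ord_recl [X in _ = _ + X]big_ord_recr /=.
rewrite !mulr0n !oppr0 subnn mulr0n oppr0 mul0r mulr0 add0r addr0.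
case: m {zM} => [|m]; first by rewrite !big_ord0 mulr0n oppr0 addr0.
rewrite -big_split -sumrMnl -sumrN /=; apply: eq_bigr => i _.
rewrite /bump /= add1n subSS subSn ?leq_ord //= mulNr mulrN mulrnAl mulrnAr.
by rewrite -opprD -mulrnDr subnKC ?leq_ord.
Qed.

Lemma zs_deriv1 : zs_deriv 1 = 0.
Proof.
by apply: zseriesP => -[|[|m]]; rewrite zcoef0 /= ?mulr0n ?mul0rn oppr0.
Qed.

End SeriesRing.

Section SeriesAlgebra.
Variables (K : nzRingType) (A : lalgType K).
Implicit Types (a b : K) (f g : zseries A).

Definition zs_scale a f := ZSeries (fun m => a *: zcoef f m).

Fact zs_scaleA a b f : zs_scale a (zs_scale b f) = zs_scale (a * b) f.
Proof. by apply: zseriesP => m /=; rewrite scalerA. Qed.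

Fact zs_scale1 : left_id 1 zs_scale.
Proof. by move=> f; apply: zseriesP => m /=; rewrite scale1r. Qed.

Fact zs_scaleDr : right_distributive zs_scale +%R.
Proof. by move=> a f g; apply: zseriesP => m /=; rewrite scalerDr. Qed.

Fact zs_scaleDl f : {morph zs_scale^~ f : a b / a + b}.
Proof. by move=> a b; apply: zseriesP => m /=; rewrite scalerDl. Qed.

HB.instance Definition _ := GRing.Zmodule_isLmodule.Build K (zseries A)
  zs_scaleA zs_scale1 zs_scaleDr zs_scaleDl.

Fact zs_scaleAl a f g : a *: (f * g) = (a *: f) * g.
Proof.
apply: zseriesP => m /=; rewrite scaler_sumr.
by apply: eq_bigr => i _; rewrite scalerAl.
Qed.

HB.instance Definition _ := GRing.Lmodule_isLalgebra.Build K (zseries A)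
  zs_scaleAl.

End SeriesAlgebra.

(* Differential operators sum_j c_j(z) d^j, with d = d/dz, over the series in
   1/z: the polynomial [dcoefs P] lists the coefficients c_j, written on the
   left of the powers of d. *)
Record diffop (A : nzRingType) := DiffOp { dcoefs : {poly zseries A} }.

Section DiffOpRing.
Variable A : nzRingType.
Local Notation S := (zseries A).
Implicit Types (p q r : {poly S}) (P Q : diffop A).

HB.instance Definition _ := gen_eqMixin (diffop A).
HB.instance Definition _ := gen_choiceMixin (diffop A).

Lemma dcoefs_inj : injective (@dcoefs A).
Proof. by case=> p [q] /= ->. Qed.

(* d (sum_j c_j d^j) = sum_j (c_j' d^j + c_j d^(j+1)) *)
Definition dmul_d p : {poly S} := map_poly (@zs_deriv A) p + p * 'X.

Definition dmul p q : {poly S} := \sum_(i < size p) p`_i *: iter i dmul_d q.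

Let dmulE N p q : (size p <= N)%N ->
  dmul p q = \sum_(i < N) p`_i *: iter i dmul_d q.
Proof.
move=> pN; pose F i := p`_i *: iter i dmul_d q.
rewrite /dmul (big_ord_widen _ F pN) {}/F big_mkcond; apply: eq_bigr => i _.
by case: ltnP => // /(nth_default _) ->; rewrite scale0r.
Qed.

Let dmul_dD p q : dmul_d (p + q) = dmul_d p + dmul_d q.
Proof. by rewrite /dmul_d raddfD mulrDl addrACA. Qed.

Let dmul_d0 : dmul_d 0 = 0.
Proof. by rewrite /dmul_d raddf0 mul0r addr0. Qed.

Let dmul_d_sum I (s : seq I) (F : I -> {poly S}) :
  dmul_d (\sum_(i <- s) F i) = \sum_(i <- s) dmul_d (F i).
Proof. exact: (big_morph _ dmul_dD dmul_d0). Qed.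

Let dmul_dZ (c : S) p : dmul_d (c *: p) = zs_deriv c *: p + c *: dmul_d p.
Proof.
rewrite /dmul_d scalerDr addrA -scalerAl; congr (_ + _).
apply/polyP => i; rewrite coefD !coefZ !coef_map_id0 ?raddf0 //.
by rewrite coefZ zs_derivM.
Qed.

Let dmulDl p q r : dmul (p + q) r = dmul p r + dmul q r.
Proof.
pose N := maxn (size p) (size q).
have [pN qN] : (size p <= N)%N /\ (size q <= N)%N.
  by rewrite leq_maxl leq_maxr.
rewrite !(@dmulE N) ?(leq_trans (size_polyD _ _)) // -big_split.
by apply: eq_bigr => i _; rewrite coefD scalerDl.
Qed.

Let dmulDr p q r : dmul r (p + q) = dmul r p + dmul r q.
Proof.
rewrite /dmul -big_split /=; apply: eq_bigr => i _.
rewrite -scalerDr; congr (_ *: _).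
by elim: (i : nat) => //= k ->; rewrite dmul_dD.
Qed.

Let dmul0 r : dmul 0 r = 0.
Proof. by rewrite /dmul size_poly0 big_ord0. Qed.

Let dmulZ (c : S) p q : dmul (c *: p) q = c *: dmul p q.
Proof.
rewrite (dmulE _ (size_scale_leq c p)) scaler_sumr.
by apply: eq_bigr => i _; rewrite coefZ scalerA.
Qed.

Let dmulX p q : dmul (dmul_d p) q = dmul_d (dmul p q).
Proof.
rewrite dmulDl dmul_d_sum.
under [RHS]eq_bigr do rewrite dmul_dZ.
rewrite big_split; congr (_ + _).
  rewrite (@dmulE (size p)) ?size_poly //.
  by apply: eq_bigr => i _; rewrite coef_map_id0 ?raddf0.
rewrite (@dmulE (size p).+1); last first.
  by rewrite (leq_trans (size_polyMleq _ _)) // size_polyX addn2.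
rewrite big_ord_recl coefMX scale0r add0r.
by apply: eq_bigr => i _; rewrite coefMX.
Qed.

Let dmul_iter i p q : dmul (iter i dmul_d p) q = iter i dmul_d (dmul p q).
Proof. by elim: i => //= i IHi; rewrite dmulX IHi. Qed.

Let dmulA : associative dmul.
Proof.
move=> p q r; rewrite [dmul p q]/dmul.
rewrite (big_morph (dmul^~ r) (fun x y => dmulDl x y r) (dmul0 r)).
by apply: eq_bigr => i _; rewrite dmulZ dmul_iter.
Qed.

Let dmul1l : left_id 1 dmul.
Proof. by move=> p; rewrite /dmul size_poly1 big_ord1 coef1 scale1r. Qed.

Let dmul_dXn k : dmul_d 'X^k = 'X^(k.+1).
Proof.
rewrite /dmul_d -exprSr.
suff -> : map_poly (@zs_deriv A) 'X^k = 0 by rewrite add0r.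
apply/polyP => j; rewrite coef_map_id0 ?raddf0 // coefXn coef0.
by case: eqP; rewrite ?raddf0 ?zs_deriv1.
Qed.

Let dmul1r : right_id 1 dmul.
Proof.
move=> p; rewrite -[RHS]coefK poly_def; apply: eq_bigr => i _; congr (_ *: _).
by elim: (i : nat) => //= k ->; rewrite dmul_dXn.
Qed.

Definition diffop_add P Q := DiffOp (dcoefs P + dcoefs Q).
Definition diffop_opp P := DiffOp (- dcoefs P).
Definition diffop_mul P Q := DiffOp (dmul (dcoefs P) (dcoefs Q)).

Fact diffop_addA : associative diffop_add.
Proof. by move=> P Q T; apply: dcoefs_inj; rewrite /= addrA. Qed.

Fact diffop_addC : commutative diffop_add.
Proof. by move=> P Q; apply: dcoefs_inj; rewrite /= addrC. Qed.

Fact diffop_add0 : left_id (DiffOp 0) diffop_add.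
Proof. by move=> P; apply: dcoefs_inj; rewrite /= add0r. Qed.

Fact diffop_addN : left_inverse (DiffOp 0) diffop_opp diffop_add.
Proof. by move=> P; apply: dcoefs_inj; rewrite /= addNr. Qed.

HB.instance Definition _ := GRing.isZmodule.Build (diffop A)
  diffop_addA diffop_addC diffop_add0 diffop_addN.

Fact diffop_mulA : associative diffop_mul.
Proof. by move=> P Q T; apply: dcoefs_inj; rewrite /= dmulA. Qed.

Fact diffop_mul1l : left_id (DiffOp 1) diffop_mul.
Proof. by move=> P; apply: dcoefs_inj; rewrite /= dmul1l. Qed.

Fact diffop_mul1r : right_id (DiffOp 1) diffop_mul.
Proof. by move=> P; apply: dcoefs_inj; rewrite /= dmul1r. Qed.

Fact diffop_mulDl : left_distributive diffop_mul +%R.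
Proof. by move=> P Q T; apply: dcoefs_inj; rewrite /= dmulDl. Qed.

Fact diffop_mulDr : right_distributive diffop_mul +%R.
Proof. by move=> P Q T; apply: dcoefs_inj; rewrite /= dmulDr. Qed.

Fact diffop_one_neq0 : DiffOp 1 != 0.
Proof. by rewrite -(inj_eq dcoefs_inj) /= oner_eq0. Qed.

HB.instance Definition _ := GRing.Zmodule_isNzRing.Build (diffop A)
  diffop_mulA diffop_mul1l diffop_mul1r diffop_mulDl diffop_mulDr
  diffop_one_neq0.

Definition dz : diffop A := DiffOp 'X.
Definition diffop_of_series (f : S) : diffop A := DiffOp f%:P.

Lemma dz_commutator f :
  dz * diffop_of_series f - diffop_of_series f * dz
    = diffop_of_series (zs_deriv f).
Proof.
apply: dcoefs_inj; rewrite /= /dmul size_polyX !big_ord_recr big_ord0 /=.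
rewrite !coefX /= scale0r scale1r !add0r /dmul_d map_polyC /=.
rewrite size_polyC; case: eqP => [->|_] /=.
  by rewrite big_ord0 subr0 mul0r addr0.
by rewrite big_ord1 coefC /= mul_polyC addrK.
Qed.

Lemma diffopE P :
  P = \sum_(j < size (dcoefs P)) diffop_of_series (dcoefs P)`_j * dz ^+ j.
Proof.
have dcoefs_sum (I : Type) (s : seq I) (F : I -> diffop A) :
    dcoefs (\sum_(i <- s) F i) = \sum_(i <- s) dcoefs (F i).
  exact: (big_morph (@dcoefs A) (fun _ _ => erefl) erefl).
have dzX j : dcoefs (dz ^+ j) = 'X^j.
  elim: j => [|j IHj]; first by rewrite !expr0.
  rewrite exprS /= IHj /dmul size_polyX !big_ord_recr big_ord0 /=.
  by rewrite !coefX /= scale0r scale1r !add0r dmul_dXn.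
apply: dcoefs_inj => /=; rewrite dcoefs_sum -[LHS]coefK poly_def.
apply: eq_bigr => j _ /=; rewrite dzX /dmul size_polyC.
case: eqP => [->|_] /=; first by rewrite big_ord0 scale0r.
by rewrite big_ord1 coefC.
Qed.

End DiffOpRing.

Section DiffOpAlgebra.
Variables (K : nzRingType) (A : lalgType K).
Implicit Types (a b : K) (P Q : diffop A).

Definition diffop_scale a P : diffop A :=
  DiffOp ((a%:A : zseries A) *: dcoefs P).

Fact diffop_scaleA a b P :
  diffop_scale a (diffop_scale b P) = diffop_scale (a * b) P.
Proof. by apply: dcoefs_inj; rewrite /= scalerA -scalerAl mul1r scalerA. Qed.

Fact diffop_scale1 : left_id 1 diffop_scale.
Proof. by move=> P; apply: dcoefs_inj; rewrite /= !scale1r. Qed.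

Fact diffop_scaleDr : right_distributive diffop_scale +%R.
Proof. by move=> a P Q; apply: dcoefs_inj; rewrite /= scalerDr. Qed.

Fact diffop_scaleDl P : {morph diffop_scale^~ P : a b / a + b}.
Proof. by move=> a b; apply: dcoefs_inj; rewrite /= !scalerDl. Qed.

HB.instance Definition _ := GRing.Zmodule_isLmodule.Build K (diffop A)
  diffop_scaleA diffop_scale1 diffop_scaleDr diffop_scaleDl.

Fact diffop_scaleAl a P Q : a *: (P * Q) = (a *: P) * Q.
Proof.
apply: dcoefs_inj; rewrite /= /dmul scaler_sumr.
set c := a%:A.
have := size_scale_leq c (dcoefs P).
pose F i := (c *: dcoefs P)`_i *: iter i (@dmul_d A) (dcoefs Q).
move=> /(big_ord_widen _ F) ->; rewrite {}/F.
rewrite [RHS]big_mkcond; apply: eq_bigr => i _.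
case: ltnP => [|/(nth_default 0) e]; first by rewrite coefZ scalerA.
by rewrite scalerA -coefZ e scale0r.
Qed.

HB.instance Definition _ := GRing.Lmodule_isLalgebra.Build K (diffop A)
  diffop_scaleAl.

End DiffOpAlgebra.

(* The factors of \prod are multiplied in increasing order of the index. *)
Definition col_det (A : nzRingType) n (N : 'M[A]_n) : A :=
  \sum_(s : 'S_n) (-1) ^+ s * \prod_(j < n) N (s j) j.

Definition row_perm_fun (A : nzRingType) k (N : 'M[A]_k) : A :=
  \sum_(s : 'S_k) \prod_(i < k) N i (s i).

Definition trace_sym (K : fieldType) (A : lalgType K) n (M : 'M[A]_n)
    (k : nat) : A :=
  k`!%:R^-1 *:
    \sum_(l : {ffun 'I_k -> 'I_n}) row_perm_fun (\matrix_(a, b) M (l a) (l b)).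

Definition generated_subalg (K : nzRingType) (A : lalgType K) (G : set A) :
    set A :=
  smallest (fun B : set A => GRing.subalg_closed [in B]) G.

Section BetheSubalgebra.
Variables (K : fieldType) (n : nat).

Local Notation U := (uea (gl_current K n)).

Definition current_gen (i j : 'I_n) (r : nat) : U :=
  uea_gen ('X^r *: delta_mx i j : gl_current K n).

Definition lax_matrix : 'M[zseries U]_n :=
  \matrix_(i, j) ZSeries (fun m => if m is r.+1 then current_gen i j r else 0).

Definition dz_sub_lax : 'M[diffop U]_n :=
  (dz U)%:M - map_mx (@diffop_of_series U) lax_matrix.

(* col_det dz_sub_lax = \sum_(i <= n) QH_i d^i *)
Definition QH (i : nat) : zseries U := (dcoefs (col_det dz_sub_lax))`_i.

(* The unital subalgebra generated by the coefficients of QH_0, ..., QH_n.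
   That it is commutative is a theorem, not part of the definition. *)
Definition bethe : set U :=
  generated_subalg (\bigcup_(i in `I_n.+1) range (zcoef (QH i))).

(* trace_sym dz_sub_lax k = \sum_(j <= k) c_(j,k) d^j *)
Definition sym_coef (j k : nat) : zseries U :=
  (dcoefs (trace_sym dz_sub_lax k))`_j.

Definition sym_series (k : nat) : zseries U := (-1) ^+ k * sym_coef 0 k.

End BetheSubalgebra.

Arguments bethe : clear implicits.

(* Main.v *)
Require Import Defs.
From mathcomp Require Import all_boot all_order all_fingroup all_algebra.
From mathcomp Require Import boolp classical_sets reals complex.
From HB Require Import structures.
From mathcomp Require Import zify ring.

(* The entries of M = d/dz - L(z) satisfy the Manin relations
   [M_ij, M_kl] = [M_kj, M_il]. For such a matrix, the traces
   A_l = Tr Lambda^l M = sum of the principal minors and H_m = Tr S^m M satisfy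
   MacMahon's identity sum_l (-1)^l A_l H_(k-l) = 0 for k > 0. The formal
   derivative with respect to d/dz is a derivation of the ring of differential
   operators which sends M to the identity matrix, hence A_(l+1) to
   (n - l) A_l; starting from A_n = det^col M, it expresses the coefficients of
   every A_l as multiples of the QH_i. The coefficient of (d/dz)^0 in
   MacMahon's identity is therefore a recursion relating the c_(0,k) and their
   z-derivatives to the QH_i, which can be solved for either family in terms of
   the other. *)

Set Implicit Arguments.
Unset Strict Implicit.
Unset Printing Implicit Defensive.
Import GRing.Theory Num.Theory.

Local Open Scope ring_scope.

(** * Generation and cosets of the symmetric group *)

(** An adjacent transposition conjugates a transposition at distance [d + 2] to one at distance
    [d + 1]. Symmetries of minors are thus reduced to neighbouring factors, where the Manin
    relations apply. *)
Lemma perm_adjacent_ind k (P : 'S_k -> Prop) :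
    P 1%g -> (forall s t, P s -> P t -> P (s * t)%g) ->
    (forall x y : 'I_k, y = x.+1 :> nat -> P (tperm x y)) ->
  forall s, P s.
Proof.
move=> P1 PM Padj.
have Plt d : forall x y : 'I_k, (y = x + d.+1 :> nat)%N -> P (tperm x y).
  elim: d => [|d IHd] x y yE; first by apply: Padj; rewrite yE addn1.
  have zk : (x + d.+1 < k)%N by have := ltn_ord y; lia.
  pose z := Ordinal zk.
  have Pzy : P (tperm z y) by apply: Padj; rewrite yE addnS.
  suff -> : tperm x y = (tperm z y * tperm x z * tperm z y)%g.
    by apply: (PM _ _ (PM _ _ Pzy _) Pzy); apply: IHd.
  rewrite -{1}[tperm z y]tpermV -mulgA -conjgE tpermJ tpermL tpermD //.
    by rewrite -val_eqE /= -[X in _ != X]addn0 eqn_add2l.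
  by rewrite -val_eqE /= yE -[X in _ != X]addn0 eqn_add2l.
have Pt x y : P (tperm x y).
  case: (ltngtP x y) => [xy|yx|/val_inj ->]; last by rewrite tperm1.
    by apply: (Plt (y - x).-1); lia.
  by rewrite tpermC; apply: (Plt (x - y).-1); lia.
move=> s; have [ts -> _] := prod_tpermP s.
by elim: ts => [|t ts IHts]; rewrite ?big_nil // big_cons; apply: PM.
Qed.

(** Coset decomposition behind the Laplace expansions: [s] is uniquely a permutation fixing [x]
    followed by [tperm x (s x)]. *)
Lemma sum_perm_tperm (V : nmodType) k (x : 'I_k.+1) (f : 'S_k.+1 -> V) :
  \sum_s f s
    = \sum_p \sum_(t : 'S_k) f (lift_perm x x t * tperm x p)%g.
Proof.
pose F (u : 'I_k.+1 * 'S_k) := (lift_perm x x u.2 * tperm x u.1)%g.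
have Fx u : F u x = u.1 by rewrite permM lift_perm_id tpermL.
have Finj : injective F.
  move=> [p s] [q t] eqF; have /= pq := Fx (p, s).
  rewrite eqF Fx /= in pq; rewrite -{}pq in eqF *; congr (_, _).
  move/mulIg: eqF => /= st; apply/permP => a.
  by have /permP/(_ (lift x a)) := st; rewrite !lift_perm_lift => /lift_inj.
have Fbij : bijective F.
  by apply: inj_card_bij; rewrite // card_prod !card_Sn card_ord.
rewrite pair_bigA /= (reindex F) //.
exact: onW_bij.
Qed.

(** * Words *)

Section Words.
Variable T : finType.
Implicit Types (k : nat) (c : T).

Definition winsert k (x : 'I_k.+1) c (f : {ffun 'I_k -> T}) :
    {ffun 'I_k.+1 -> T} :=
  [ffun a => if unlift x a is Some b then f b else c].

Definition wdelete k (x : 'I_k.+1) (f : {ffun 'I_k.+1 -> T}) :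
    {ffun 'I_k -> T} := [ffun a => f (lift x a)].

Definition wset k (f : {ffun 'I_k -> T}) (x : 'I_k) c : {ffun 'I_k -> T} :=
  [ffun a => if a == x then c else f a].

Definition wperm k (f : {ffun 'I_k -> T}) (s : 'S_k) : {ffun 'I_k -> T} :=
  [ffun a => f (s a)].

Lemma winsert_id k (x : 'I_k.+1) c f : winsert x c f x = c.
Proof. by rewrite ffunE unlift_none. Qed.

Lemma winsert_lift k (x : 'I_k.+1) c f a : winsert x c f (lift x a) = f a.
Proof. by rewrite ffunE liftK. Qed.

Lemma winsertK k (x : 'I_k.+1) c : cancel (winsert x c) (wdelete x).
Proof. by move=> f; apply/ffunP => a; rewrite ffunE winsert_lift. Qed.

Lemma wdeleteK k (x : 'I_k.+1) (f : {ffun 'I_k.+1 -> T}) :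
  winsert x (f x) (wdelete x f) = f.
Proof.
apply/ffunP => a; rewrite ffunE; case: unliftP => [b ->|-> //].
by rewrite ffunE.
Qed.

Lemma wpermM k (f : {ffun 'I_k -> T}) s t :
  wperm f (s * t)%g = wperm (wperm f t) s.
Proof. by apply/ffunP => a; rewrite !ffunE permM. Qed.

Lemma wperm1 k (f : {ffun 'I_k -> T}) : wperm f 1%g = f.
Proof. by apply/ffunP => a; rewrite ffunE perm1. Qed.

Lemma wperm_bij k (s : 'S_k) :
  bijective (fun f : {ffun 'I_k -> T} => wperm f s).
Proof.
exists (fun f => wperm f s^-1%g) => f.
  by rewrite -wpermM mulVg wperm1.
by rewrite -wpermM mulgV wperm1.
Qed.

Lemma wdelete_tperm k (x : 'I_k.+1) c f q :
  wdelete x (wperm (winsert x c f) (tperm x (lift x q))) = wset f q c.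
Proof.
apply/ffunP => a; rewrite !ffunE; case: eqP => [->|/eqP aq].
  by rewrite tpermR unlift_none.
by rewrite tpermD ?neq_lift // ?liftK // (inj_eq (@lift_inj _ x)) eq_sym.
Qed.

Lemma wdelete_tperm_id k (x : 'I_k.+1) (f : {ffun 'I_k.+1 -> T}) :
  wdelete x (wperm f (tperm x x)) = wdelete x f.
Proof. by rewrite tperm1 wperm1. Qed.

Lemma wset_tperm k (x q : 'I_k.+1) c d f :
  wset (wperm (winsert x d f) (tperm x q)) q c
    = wperm (winsert x c f) (tperm x q).
Proof.
apply/ffunP => a; rewrite [in LHS]ffunE.
case: eqP => [->|/eqP aq]; first by rewrite ffunE tpermR winsert_id.
rewrite !ffunE; case: tpermP aq => [-> |-> /eqP //|/eqP xa _ _].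
  by case: (unliftP x q) => [b ->|->]; rewrite // eqxx.
by case: (unliftP x a) xa => [b ->|->]; rewrite // eqxx.
Qed.

Lemma sum_winsert (V : nmodType) k (x : 'I_k.+1)
    (F : {ffun 'I_k.+1 -> T} -> V) :
  \sum_f F f = \sum_c \sum_f F (winsert x c f).
Proof.
rewrite pair_bigA /= (reindex (fun u => winsert x u.1 u.2)) //.
exists (fun f : {ffun 'I_k.+1 -> T} => (f x, wdelete x f)) => [[c f] _|f _] /=.
  by rewrite winsert_id winsertK.
by rewrite wdeleteK.
Qed.

End Words.

(** * Commutators and division by positive integers *)

Section Commutators.
Variable A : nzRingType.
Implicit Types x y z : A.

Definition commutator x y := x * y - y * x.

Lemma commutatorBl x y z :
  commutator (x - y) z = commutator x z - commutator y z.
Proof.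
rewrite /commutator mulrBl mulrBr !opprB addrACA [RHS]addrACA.
by congr (_ + _); rewrite addrC.
Qed.

Lemma commutatorN x y : commutator y x = - commutator x y.
Proof. by rewrite opprB. Qed.

Lemma commutatorBr x y z :
  commutator x (y - z) = commutator x y - commutator x z.
Proof.
by rewrite commutatorN commutatorBl opprB !(commutatorN x) opprK addrC.
Qed.

End Commutators.

Section InvNat.
Variables (K : numFieldType) (A : lalgType K).

Lemma addrr_eq0 (x : A) : x + x = 0 -> x = 0.
Proof.
move=> xx; apply/eqP; have /eqP := xx.
by rewrite -mulr2n -scaler_nat scaler_eq0 pnatr_eq0.
Qed.

(** [A] is only a left algebra, so a general scalar need not pass through [x]. The inverse of [m]
    does, because multiplication by [m] is iterated addition. *)
Lemma mulr_invn_scale (x y : A) m :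
  (0 < m)%N -> x * (m%:R^-1 *: y) = m%:R^-1 *: (x * y).
Proof.
move=> m0; have m_neq0 : m%:R != 0 :> K by rewrite pnatr_eq0 -lt0n.
apply: (scalerI m_neq0); rewrite scalerA divff // scale1r.
by rewrite scaler_nat -mulrnAr -scaler_nat scalerA divff // scale1r.
Qed.

Lemma raddf_invn_scale (delta : {additive A -> A}) m x : (0 < m)%N ->
  delta (m%:R^-1 *: x) = m%:R^-1 *: delta x.
Proof.
move=> m0; have m_neq0 : m%:R != 0 :> K by rewrite pnatr_eq0 -lt0n.
apply: (scalerI m_neq0); rewrite scalerA divff // scale1r.
by rewrite scaler_nat -raddfMn -scaler_nat scalerA divff // scale1r.
Qed.

End InvNat.

(** * MacMahon's identity for Manin matrices *)

Section ManinMatrix.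
Variables (K : numFieldType) (A : lalgType K) (n : nat) (M : 'M[A]_n).
Implicit Types (c d e : 'I_n).
Local Notation word k := {ffun 'I_k -> 'I_n}.

Definition word_prod k (i j : word k) : A := \prod_(a < k) M (i a) (j a).

(** Column determinant of the submatrix with rows [i] and columns [j]. Antisymmetry in the rows is a
    mere reindexing; in the columns it comes from the Manin relations. *)
Definition alt_minor k (i j : word k) : A :=
  \sum_(s : 'S_k) (-1) ^+ s * word_prod (wperm i s) j.

(** Row permanent of the same submatrix. Here symmetry in the columns is the formal one, and
    symmetry in the rows comes from the Manin relations. *)
Definition sym_minor k (i j : word k) : A :=
  \sum_(s : 'S_k) word_prod i (wperm j s).

Lemma word_prod_recl k (i j : word k.+1) :
  word_prod i j
    = M (i ord0) (j ord0) * word_prod (wdelete ord0 i) (wdelete ord0 j).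
Proof.
rewrite /word_prod big_ord_recl; congr (_ * _).
by apply: eq_bigr => a _; rewrite !ffunE.
Qed.

Lemma word_prod_recr k (i j : word k.+1) :
  word_prod i j
    = word_prod (wdelete ord_max i) (wdelete ord_max j)
      * M (i ord_max) (j ord_max).
Proof.
rewrite /word_prod big_ord_recr; congr (_ * _).
apply: eq_bigr => a _; rewrite !ffunE.
have -> // : widen_ord (leqnSn k) a = lift ord_max a.
by apply: val_inj; rewrite /= /bump leqNgt ltn_ord.
Qed.

Lemma wdelete_lift_perm k (x : 'I_k.+1) (i : word k.+1) t (s : 'S_k.+1) :
  wdelete x (wperm i (lift_perm x x t * s)%g) = wperm (wdelete x (wperm i s)) t.
Proof. by apply/ffunP => a; rewrite !ffunE permM lift_perm_lift. Qed.

Lemma wperm_lift_perm_id k (x : 'I_k.+1) (i : word k.+1) t (s : 'S_k.+1) :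
  wperm i (lift_perm x x t * s)%g x = i (s x).
Proof. by rewrite ffunE permM lift_perm_id. Qed.

Lemma sym_minor_recl k (i j : word k.+1) :
  sym_minor i j
    = \sum_p M (i ord0) (j p)
             * sym_minor (wdelete ord0 i)
                         (wdelete ord0 (wperm j (tperm ord0 p))).
Proof.
rewrite /sym_minor (sum_perm_tperm ord0); apply: eq_bigr => p _.
rewrite mulr_sumr; apply: eq_bigr => t _.
by rewrite word_prod_recl wperm_lift_perm_id tpermL wdelete_lift_perm.
Qed.

Lemma odd_lift_perm_tperm k (x p : 'I_k.+1) t :
  (lift_perm x x t * tperm x p)%g = (x != p) (+) odd_perm t :> bool.
Proof. by rewrite odd_permM odd_lift_perm odd_tperm addbb addFb addbC. Qed.

Lemma alt_minor_recr k (i j : word k.+1) :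
  alt_minor i j
    = \sum_p (-1) ^+ (ord_max != p)
             * alt_minor (wdelete ord_max (wperm i (tperm ord_max p)))
                         (wdelete ord_max j)
             * M (i p) (j ord_max).
Proof.
rewrite /alt_minor (sum_perm_tperm ord_max); apply: eq_bigr => p _.
rewrite mulr_sumr mulr_suml; apply: eq_bigr => t _.
rewrite word_prod_recr wperm_lift_perm_id tpermL wdelete_lift_perm.
by rewrite odd_lift_perm_tperm signr_addb !mulrA.
Qed.

(** Laplace expansion along the last column, whose entry stands rightmost. The sign is that of the
    transposition which puts [c] in the place of [i q]. *)
Lemma alt_minor_winsert k c d (i j : word k) :
  alt_minor (winsert ord_max c i) (winsert ord_max d j)
    = alt_minor i j * M c d
      - \sum_q alt_minor (wset i q c) j * M (i q) d.
Proof.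
rewrite alt_minor_recr (bigD1_ord ord_max) //= eqxx mul1r.
rewrite wdelete_tperm_id !winsertK !winsert_id; congr (_ + _).
rewrite -sumrN; apply: eq_bigr => q _.
by rewrite winsert_lift neq_lift wdelete_tperm mulN1r mulNr.
Qed.

Lemma sym_minor_winsert k c (i : word k) (j : word k.+1) :
  \sum_p M c (j p) * sym_minor i (wdelete ord0 (wperm j (tperm ord0 p)))
    = sym_minor (winsert ord0 c i) j.
Proof. by rewrite sym_minor_recl winsert_id winsertK. Qed.

Lemma sum_wperm (V : nmodType) k (s : 'S_k) (F : word k -> V) :
  \sum_i F i = \sum_i F (wperm i s).
Proof. by apply/reindex/onW_bij/wperm_bij. Qed.

Lemma alt_minor_perml k (s : 'S_k) (i j : word k) :
  alt_minor (wperm i s) j = (-1) ^+ s * alt_minor i j.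
Proof.
rewrite /alt_minor mulr_sumr (reindex_inj (mulIg s^-1%g)) /=.
apply: eq_bigr => t _; rewrite -wpermM mulgKV mulrA -signr_addb.
by rewrite odd_permM odd_permV addbC.
Qed.

Lemma sym_minor_permr k (s : 'S_k) (i j : word k) :
  sym_minor i (wperm j s) = sym_minor i j.
Proof.
rewrite /sym_minor (reindex_inj (mulIg s^-1%g)) /=.
by apply: eq_bigr => t _; rewrite -wpermM mulgKV.
Qed.

Lemma alt_minor_eq0 k (i j : word k) x y :
  x != y -> i x = i y -> alt_minor i j = 0.
Proof.
move=> xy ixy; apply: addrr_eq0.
have {1}-> : i = wperm i (tperm x y).
  by apply/ffunP => a; rewrite ffunE; case: tpermP => [->|->|].
by rewrite alt_minor_perml odd_tperm xy mulN1r addNr.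
Qed.

Definition manin := forall i j k l,
  commutator (M i j) (M k l) = commutator (M k j) (M i l).

Hypothesis maninM : manin.

(* Equivalently (1 - s) W (1 + s) = 0, with s acting on the row indices of
   W := word_prod on the left and on the column indices on the right. *)
Lemma word_prod_adjacent k (x y : 'I_k) (i j : word k) (s := tperm x y) :
    y = x.+1 :> nat ->
  word_prod i j + word_prod i (wperm j s)
    = word_prod (wperm i s) j + word_prod (wperm i s) (wperm j s).
Proof.
rewrite {}/s; elim: k x y i j => [[]//|k IHk] x y i j yE.
(* If [x] is not the first position, the first factor is common to all four words and is peeled off.
   Otherwise [y] is the second position, and the common tail leaves an identity between products of
   two entries. *)
case: (unliftP ord0 x) => [x'|] xE.
  have [y'|] := unliftP ord0 y; last by move=> y0; rewrite y0 in yE.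
  move=> y'E; have {}yE : y' = x'.+1 :> nat.
    by move: yE; rewrite xE y'E /= /bump /= => -[].
  have -> : tperm x y = (lift_perm ord0 ord0 (tperm x' y') * 1)%g.
    apply/permP => a; rewrite mulg1 xE y'E.
    case: (unliftP ord0 a) => [b|] ->.
      by rewrite lift_perm_lift inj_tperm //; apply: lift_inj.
    by rewrite lift_perm_id tpermD // eq_sym neq_lift.
  rewrite !word_prod_recl !wdelete_lift_perm !wperm_lift_perm_id.
  by rewrite !wperm1 !perm1 -!mulrDr IHk.
case: k i j {IHk} x y yE xE => [|k] i j x y yE xE.
  by have := ltn_ord y; rewrite yE xE.
have y1 : y = lift ord0 ord0 by apply: val_inj; rewrite /= yE xE.
rewrite !word_prod_recl !mulrA.
have dd (f : word k.+2) : wdelete ord0 (wdelete ord0 (wperm f (tperm x y)))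
    = wdelete ord0 (wdelete ord0 f).
  by apply/ffunP => a; rewrite !ffunE tpermD // ?xE ?y1.
have d0 (f : word k.+2) : wdelete ord0 f ord0 = f y by rewrite ffunE y1.
rewrite !dd !d0 -xE !ffunE tpermL tpermR -!mulrDl; congr (_ * _).
(* This identity is the Manin relation with its negative terms moved across. *)
have /eqP := maninM (i x) (j x) (i y) (j y).
by rewrite subr_eq addrAC eq_sym subr_eq eq_sym => /eqP.
Qed.

Lemma alt_minor_permr k (s : 'S_k) (i j : word k) :
  alt_minor i (wperm j s) = (-1) ^+ s * alt_minor i j.
Proof.
elim/perm_adjacent_ind: s i j => [|s t IHs IHt|x y yE] i j.
- by rewrite wperm1 odd_perm1 mul1r.
- by rewrite wpermM IHs IHt mulrA -signr_addb odd_permM.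
have xy : x != y by rewrite -val_eqE /= yE neq_ltn ltnSn.
rewrite odd_tperm xy mulN1r; apply/eqP; rewrite -addr_eq0 addrC.
pose t := tperm x y; pose F (u : 'S_k) := (-1) ^+ u
  * (word_prod (wperm i u) j + word_prod (wperm i u) (wperm j t)).
have -> : alt_minor i j + alt_minor i (wperm j t) = \sum_u F u.
  by rewrite -big_split; apply: eq_bigr => u _; rewrite [RHS]mulrDr.
(* In twice the sum, the terms of [u] and [t * u] have opposite signs and cancel by the adjacent
   relation. *)
apply/eqP/addrr_eq0; rewrite [X in _ + X](reindex_inj (mulgI t)) -big_split /=.
apply: big1 => u _; rewrite /F odd_permM odd_tperm xy !wpermM.
by rewrite -word_prod_adjacent // signr_addb mulN1r mulNr subrr.
Qed.

Lemma sym_minor_perml k (s : 'S_k) (i j : word k) :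
  sym_minor (wperm i s) j = sym_minor i j.
Proof.
elim/perm_adjacent_ind: s i j => [|s t IHs IHt|x y yE] i j.
- by rewrite wperm1.
- by rewrite wpermM IHs IHt.
apply/eqP; rewrite -subr_eq0; apply/eqP/addrr_eq0.
pose t := tperm x y; pose F (u : 'S_k) :=
  word_prod (wperm i t) (wperm j u) - word_prod i (wperm j u).
have -> : sym_minor (wperm i t) j - sym_minor i j = \sum_u F u.
  by rewrite -sumrB.
rewrite [X in _ + X](reindex_inj (mulgI t)) -big_split /=.
apply: big1 => u _; rewrite /F !wpermM addrACA -opprD.
by rewrite -word_prod_adjacent // subrr.
Qed.

Lemma alt_minor_perm k (s : 'S_k) (i j : word k) :
  alt_minor (wperm i s) (wperm j s) = alt_minor i j.
Proof.
by rewrite alt_minor_perml alt_minor_permr mulrA -signr_addb addbb mul1r.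
Qed.

Lemma sym_minor_perm k (s : 'S_k) (i j : word k) :
  sym_minor (wperm i s) (wperm j s) = sym_minor i j.
Proof. by rewrite sym_minor_perml sym_minor_permr. Qed.

Definition minor_prod l m : A :=
  \sum_(i : word l) \sum_(y : word m) alt_minor i i * sym_minor y y.

(* minor_prod l m is l! m! A_l H_m. Writing X = M_1 ... M_k on a tensor power,
   minor_hook l m is tr (S P X) for the unnormalized symmetrizer S of the
   positions l, ..., l + m and antisymmetrizer P of the positions 0, ..., l,
   which overlap in the position l, while minor_link l m is tr (S t P X), where
   the blocks 0, ..., l and l + 1, ..., l + m + 1 are disjoint and t exchanges
   l and l + 1. *)
Definition minor_link l m : A :=
  \sum_(i : word l) \sum_(y : word m) \sum_c \sum_e
    alt_minor (winsert ord_max c i) (winsert ord_max e i)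
    * sym_minor (winsert ord0 e y) (winsert ord0 c y).

Definition minor_hook l m : A :=
  \sum_(i : word l) \sum_(y : word m.+1) \sum_p
    alt_minor (winsert ord_max (y ord0) i) (winsert ord_max (y p) i)
    * sym_minor (wdelete ord0 y) (wdelete ord0 (wperm y (tperm ord0 p))).

(** The term [p = ord0] gives the product of traces; each of the [m] other positions gives the same
    link. *)
Lemma minor_hook_row l m :
  minor_hook l m = minor_prod l.+1 m + minor_link l m.-1 *+ m.
Proof.
transitivity (\sum_(i : word l) \sum_c \sum_(y : word m)
   (alt_minor (winsert ord_max c i) (winsert ord_max c i) * sym_minor y y
    + \sum_q alt_minor (winsert ord_max c i) (winsert ord_max (y q) i)
             * sym_minor y (wset y q c))).
  apply: eq_bigr => i _; rewrite (sum_winsert ord0); apply: eq_bigr => c _.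
  apply: eq_bigr => y _; rewrite (bigD1_ord ord0) //=.
  rewrite wdelete_tperm_id winsertK winsert_id; congr (_ + _).
  by apply: eq_bigr => q _; rewrite wdelete_tperm winsert_lift.
under eq_bigr do under eq_bigr do rewrite big_split.
under eq_bigr do rewrite big_split.
rewrite big_split; congr (_ + _).
  by rewrite /minor_prod (sum_winsert ord_max) exchange_big.
case: m => [|m] /=.
  by rewrite mulr0n; do 3!rewrite big1 // => ? _; rewrite big_ord0.
rewrite /minor_link -sumrMnl; apply: eq_bigr => i _.
rewrite [in RHS]exchange_big -sumrMnl; apply: eq_bigr => c _ /=.
rewrite exchange_big -[X in _ *+ X]card_ord -sumr_const.
apply: eq_bigr => q _ /=.
(* Permuting the letters of [y] brings position [q] to the front, which makes the term independent
   of [q]; the letter overwritten by [c] becomes [e]. *)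
rewrite (sum_wperm (tperm ord0 q)) (sum_winsert ord0) exchange_big.
apply: eq_bigr => y _; apply: eq_bigr => e _; rewrite wset_tperm sym_minor_perm.
by rewrite [wperm _ _ q]ffunE tpermR winsert_id.
Qed.

(* Laplace expansion of the alternating factor along its last column. *)
Lemma minor_hook_col l m :
  minor_hook l m = minor_prod l m.+1 - minor_link l.-1 m *+ l.
Proof.
transitivity (\sum_(i : word l) \sum_(y : word m.+1)
   (alt_minor i i * sym_minor y y
    - \sum_q alt_minor (wset i q (y ord0)) i
             * sym_minor (winsert ord0 (i q) (wdelete ord0 y)) y)).
  apply: eq_bigr => i _; apply: eq_bigr => y _.
  (* After the expansion, the sum over [p] is a first-row expansion and reassembles a permanent of
     size [m.+1]. *)
  under eq_bigr do
    rewrite alt_minor_winsert mulrBl -mulrA [X in _ - X]mulr_suml.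
  rewrite sumrB.
  rewrite -mulr_sumr sym_minor_winsert wdeleteK exchange_big.
  congr (_ - _); apply: eq_bigr => q _.
  under eq_bigr do rewrite -mulrA.
  by rewrite -mulr_sumr sym_minor_winsert.
under eq_bigr do rewrite sumrB.
rewrite sumrB; congr (_ - _).
case: l => [|l] /=.
  by rewrite mulr0n; do 2!rewrite big1 // => ? _; rewrite big_ord0.
rewrite exchange_big (sum_winsert ord0) /= exchange_big /=.
rewrite /minor_link [in RHS]exchange_big -sumrMnl /=; apply: eq_bigr => y _.
rewrite [in RHS]exchange_big -sumrMnl /=; apply: eq_bigr => c _ /=.
rewrite exchange_big -[X in _ *+ X]card_ord -sumr_const.
apply: eq_bigr => q _ /=.
(* Same renaming on the alternating side: the signs from the rows and from the columns cancel. *)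
rewrite (sum_wperm (tperm ord_max q)) (sum_winsert ord_max) exchange_big.
apply: eq_bigr => i _; apply: eq_bigr => e _.
rewrite !winsert_id winsertK wset_tperm alt_minor_perm.
by rewrite [wperm _ _ q]ffunE tpermR winsert_id.
Qed.

(* The links cancel. For l = 0 or m = 0, the term with the truncated predecessor
   is multiplied by 0. *)
Lemma minor_prod_hooks l m :
  minor_prod l m *+ (l + m) = minor_hook l.-1 m *+ l + minor_hook l m.-1 *+ m.
Proof.
rewrite mulrnDr; case: l m => [|l] [|m] //=; rewrite ?mulr0n ?add0r ?addr0.
- by rewrite minor_hook_col mulr0n subr0.
- by rewrite minor_hook_row mulr0n addr0.
rewrite minor_hook_row [minor_hook _ m]minor_hook_col mulrnDl mulrnBl /=.
by rewrite -!mulrnA [(l.+1 * _)%N]mulnC addrACA subrr addr0.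
Qed.

(** Division by [l!] compensates for the orderings of each set of [l] indices, as in [trace_sym]. *)
Definition trace_alt l : A := l`!%:R^-1 *: \sum_(i : word l) alt_minor i i.

Lemma trace_symE k :
  trace_sym M k = k`!%:R^-1 *: \sum_(y : word k) sym_minor y y.
Proof.
congr (_ *: _); apply: eq_bigr => y _; apply: eq_bigr => s _.
by apply: eq_bigr => a _; rewrite !mxE ffunE.
Qed.

Lemma trace_alt_sym l m :
  trace_alt l * trace_sym M m = (l`! * m`!)%:R^-1 *: minor_prod l m.
Proof.
rewrite /trace_alt trace_symE mulr_invn_scale ?fact_gt0 // -scalerAl scalerA.
rewrite natrM invfM mulrC mulr_suml; congr (_ *: _).
by apply: eq_bigr => i _; rewrite mulr_sumr.
Qed.

Theorem macmahon_manin k : (0 < k)%N ->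
  \sum_(l < k.+1) (-1) ^+ l * (trace_alt l * trace_sym M (k - l)) = 0.
Proof.
move=> k0.
(* A_l H_(k-l) = g l + g l.+1, so that the alternating sum telescopes. *)
pose g l : A := if (0 < l <= k)%N
  then (k * (l.-1)`! * (k - l)`!)%:R^-1 *: minor_hook l.-1 (k - l) else 0.
have gE l : (l <= k)%N -> trace_alt l * trace_sym M (k - l) = g l + g l.+1.
  move=> lk; rewrite trace_alt_sym.
  have k_neq0 : k%:R != 0 :> K by rewrite pnatr_eq0 -lt0n.
  (* Multiplication by [k = l + (k - l)] gives the left side of [minor_prod_hooks]; the
     multiplicities [l] and [k - l] on its right side then cancel against the factorials. *)
  apply: (scalerI k_neq0); rewrite scalerA mulrC -scalerA scaler_nat.
  have -> : minor_prod l (k - l) *+ k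
      = minor_hook l.-1 (k - l) *+ l + minor_hook l (k - l).-1 *+ (k - l).
    by rewrite -minor_prod_hooks subnKC.
  rewrite !scalerDr.
  have cancel_factor (a b c : nat) (x : A) :
      (0 < a)%N -> (0 < b)%N -> (0 < c)%N ->
      (a * b * c)%:R^-1 *: (x *+ a) = k%:R *: ((k * b * c)%:R^-1 *: x).
    move=> a0 b0 c0; rewrite -[x *+ a]scaler_nat !scalerA.
    congr (_ *: _); rewrite !natrM !invfM.
    by field; rewrite !pnatr_eq0 -!lt0n k0 a0 b0 c0.
  congr (_ + _); rewrite /g.
    case: l lk => [|l] lk; first by rewrite mulr0n !scaler0.
    by rewrite lk factS cancel_factor ?fact_gt0.
  case: (ltnP l k) => [lk'|kl] /=; last first.
    have -> : (k - l = 0)%N by lia.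
    by rewrite ?andbF mulr0n !scaler0.
  have -> : (k - l = (k - l.+1).+1)%N by lia.
  by rewrite factS mulnA [(l`! * _)%N]mulnC cancel_factor ?fact_gt0.
have -> : \sum_(l < k.+1) (-1) ^+ l * (trace_alt l * trace_sym M (k - l))
    = \sum_(0 <= l < k.+1) ((-1) ^+ l * g l - (-1) ^+ l.+1 * g l.+1).
  rewrite big_mkord; apply: eq_bigr => l _.
  by rewrite gE -1?ltnS // exprS mulN1r mulNr opprK mulrDr.
under eq_bigr do rewrite -opprB.
(* Both ends vanish by the guard [0 < l <= k] in [g]. *)
by rewrite sumrN telescope_sumr // /g /= ltnn ?andbF !mulr0 subr0 oppr0.
Qed.

Lemma trace_alt0 : trace_alt 0 = 1.
Proof.
rewrite /trace_alt fact0 invr1 scale1r.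
rewrite (big_pred1 [ffun a => widen_ord (leq0n n) a]); last first.
  by move=> f /=; apply/esym/eqP/ffunP => -[].
rewrite /alt_minor (big_pred1 1%g); last first.
  by move=> s /=; apply/esym/eqP/permP => -[].
by rewrite odd_perm1 mul1r /word_prod big_ord0.
Qed.

Lemma trace_alt_gt l : (n < l)%N -> trace_alt l = 0.
Proof.
move=> nl; rewrite /trace_alt big1 ?scaler0 // => i _.
have /injectivePn[x [y xy ixy]] : ~~ injectiveb i.
  apply/negP => /injectiveP/leq_card; rewrite !card_ord => ln.
  by rewrite ltnNge ln in nl.
exact: alt_minor_eq0 xy ixy.
Qed.

(** Words with a repeated letter contribute zero. The [n!] others are permutations of the identity
    word, and permuting rows and columns together preserves the minor. *)
Lemma trace_alt_col_det : trace_alt n = col_det M.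
Proof.
pose e : word n := [ffun a => a].
have eE : alt_minor e e = col_det M.
  apply: eq_bigr => s _; congr (_ * _); apply: eq_bigr => a _.
  by rewrite !ffunE.
rewrite /trace_alt (bigID (fun i : word n => injectiveb i)) /=.
rewrite [X in _ + X]big1 ?addr0; last first.
  by move=> i /injectivePn[x [y xy ixy]]; apply: alt_minor_eq0 xy ixy.
rewrite (reindex (@pval _)) /=; last first.
  pose in_Sn := insubd (1%g : 'S_n).
  by exists in_Sn => /= f Uf; first apply: val_inj; apply: insubdK.
transitivity (n`!%:R^-1 *: \sum_(s in [set: 'S_n]) col_det M).
  congr (_ *: _); apply: eq_big => [s|s _]; first by rewrite inE (valP s).
  rewrite -eE.
  have -> : pval s = wperm e s by apply/ffunP => a; rewrite !ffunE pvalE.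
  by rewrite alt_minor_perm.
rewrite sumr_const cardsT card_Sn -scaler_nat scalerA mulVf ?scale1r //.
by rewrite pnatr_eq0 -lt0n fact_gt0.
Qed.

End ManinMatrix.

(** * Derivations sending a matrix to the identity *)

Section Derivation.
Variables (K : numFieldType) (A : lalgType K) (n : nat) (M : 'M[A]_n).
Variable delta : {additive A -> A}.
Hypothesis deltaM : forall x y, delta (x * y) = delta x * y + x * delta y.
Hypothesis deltaE : forall i j, delta (M i j) = (i == j)%:R.
Local Notation word k := {ffun 'I_k -> 'I_n}.

Lemma delta_word_prod k (i j : word k.+1) :
  delta (word_prod M i j)
    = \sum_b (i b == j b)%:R * word_prod M (wdelete b i) (wdelete b j).
Proof.
elim: k i j => [|k IHk] i j; rewrite word_prod_recl deltaM deltaE.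
  rewrite big_ord1 [X in _ + _ * delta X]/word_prod big_ord0.
  have /eqP : delta 1 = delta 1 + delta 1.
    by rewrite -{1}[1]mulr1 deltaM mulr1 mul1r.
  by rewrite -subr_eq0 opprD addNKr oppr_eq0 => /eqP ->; rewrite mulr0 addr0.
rewrite big_ord_recl IHk mulr_sumr; congr (_ + _); apply: eq_bigr => b _.
rewrite [in RHS]word_prod_recl !ffunE !mulr_natl mulrnAr.
have l0 : lift (lift ord0 b) ord0 = ord0 :> 'I_k.+2 by apply: val_inj.
have dd (f : word k.+2) : wdelete b (wdelete ord0 f)
    = wdelete ord0 (wdelete (lift ord0 b) f).
  apply/ffunP => a; rewrite !ffunE; congr (f _); apply: val_inj.
  by rewrite /= /bump /= !add1n ltnS addnS.
by rewrite !l0 !dd.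
Qed.

(** Each of the [l.+1] positions [b] that can be differentiated contributes the same. If [s] fixes
    [b], the letter at [b] is free, with [n] choices; otherwise it must equal one of the [l]
    remaining letters, with sign -1. *)
Lemma sum_delta_alt_minor l :
  \sum_(i : word l.+1) delta (alt_minor M i i)
    = (\sum_(i : word l) alt_minor M i i *+ n
       - \sum_(i : word l) alt_minor M i i *+ l) *+ l.+1.
Proof.
transitivity (\sum_b \sum_(i : word l.+1) \sum_(s : 'S_l.+1)
    (-1) ^+ s * ((i (s b) == i b)%:R
    * word_prod M (wdelete b (wperm i s)) (wdelete b i))).
  rewrite exchange_big; apply: eq_bigr => i _.
  rewrite exchange_big raddf_sum; apply: eq_bigr => s _.
  rewrite raddfMsign delta_word_prod mulr_sumr.
  by apply: eq_bigr => b _; rewrite [wperm i s b]ffunE.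
rewrite -[X in _ *+ X]card_ord -sumr_const; apply: eq_bigr => b _.
transitivity (\sum_(i : word l) \sum_c
    (alt_minor M i i
     - \sum_q (i q == c)%:R * alt_minor M (wset i q c) i)).
  rewrite (sum_winsert b) exchange_big; apply: eq_bigr => i _.
  apply: eq_bigr => c _; rewrite (sum_perm_tperm b) (bigD1_ord b) //=.
  congr (_ + _).
    apply: eq_bigr => t _; rewrite odd_lift_perm_tperm eqxx permM lift_perm_id.
    by rewrite tpermL eqxx mul1r wdelete_lift_perm wdelete_tperm_id winsertK.
  rewrite -sumrN; apply: eq_bigr => q _; rewrite mulr_natl /alt_minor.
  rewrite -mulNrn -sumrN -sumrMnl; apply: eq_bigr => t _.
  rewrite odd_lift_perm_tperm neq_lift permM lift_perm_id tpermL.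
  rewrite winsert_id winsert_lift wdelete_lift_perm wdelete_tperm winsertK.
  by rewrite signr_addb mulN1r mulNr mulr_natl mulrnAr mulNrn.
rewrite -sumrB; apply: eq_bigr => i _; rewrite sumrB sumr_const card_ord.
congr (_ - _); rewrite exchange_big -[X in _ *+ X](card_ord l) -sumr_const.
(* Only [c = i q] survives, and then [wset] changes nothing. *)
apply: eq_bigr => q _; rewrite (bigD1 (i q)) //= eqxx mul1r big1 ?addr0.
  congr (alt_minor _ _ _); apply/ffunP => a; rewrite ffunE.
  by case: eqP => // ->.
by move=> c; rewrite eq_sym => /negPf ->; rewrite mul0r.
Qed.

Lemma delta_trace_alt l : (l <= n)%N ->
  delta (trace_alt M l.+1) = trace_alt M l *+ (n - l).
Proof.
move=> ln; rewrite /trace_alt raddf_invn_scale ?fact_gt0 // raddf_sum.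
rewrite sum_delta_alt_minor !sumrMnl -mulrnBr // -!scaler_nat !scalerA.
congr (_ *: _); rewrite factS natrM invfM mulrACA mulVf ?pnatr_eq0 //.
by rewrite mul1r mulrC.
Qed.

End Derivation.

(** * Differential operators and the Lax matrix *)

Section DiffOps.
Variable A : nzRingType.
Implicit Types (P Q : diffop A) (p q : {poly zseries A}) (f g : zseries A).

Definition diffop_coef j P : zseries A := (dcoefs P)`_j.

Fact diffop_coef_zmod_morphism j : zmod_morphism (diffop_coef j).
Proof. by move=> P Q; rewrite /diffop_coef /= coefB. Qed.

HB.instance Definition _ j :=
  GRing.isZmodMorphism.Build _ _ (diffop_coef j) (diffop_coef_zmod_morphism j).

(** This is the commutator of [P] with [z], defined on coefficients because [z] is not a series in
    [1/z]. *)
Definition diffop_formal_deriv P : diffop A := DiffOp (dcoefs P)^`().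

Fact diffop_formal_deriv_zmod_morphism : zmod_morphism diffop_formal_deriv.
Proof. by move=> P Q; apply: dcoefs_inj; rewrite /= derivB. Qed.

HB.instance Definition _ := GRing.isZmodMorphism.Build _ _ diffop_formal_deriv
  diffop_formal_deriv_zmod_morphism.

Lemma dmul_widen N p q : (size p <= N)%N ->
  dmul p q = \sum_(i < N) p`_i *: iter i (@dmul_d A) q.
Proof.
move=> pN; pose F i := p`_i *: iter i (@dmul_d A) q.
rewrite /dmul (big_ord_widen _ F pN) {}/F big_mkcond; apply: eq_bigr => i _.
by case: ltnP => // /(nth_default _) ->; rewrite scale0r.
Qed.

(** Leibniz rule for the left factor d/dz, whose formal derivative is 1. *)
Lemma deriv_dmul_d q : (dmul_d q)^`() = dmul_d q^`() + q.
Proof.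
have dX : (q * 'X)^`() = q + q^`() * 'X.
  by have := derivMXaddC q 0; rewrite addr0.
rewrite /dmul_d derivD {}dX [q + _]addrC addrA; congr (_ + _ + _).
apply/polyP => i; rewrite !(coef_deriv, coef_map_id0) ?raddf0 //.
by rewrite raddfMn.
Qed.

Lemma dmul_dD p q : dmul_d (p + q) = dmul_d p + dmul_d q.
Proof. by rewrite /dmul_d raddfD mulrDl addrACA. Qed.

Lemma deriv_iter_dmul_d i q :
  (iter i (@dmul_d A) q)^`()
    = iter i (@dmul_d A) q^`() + iter i.-1 (@dmul_d A) q *+ i.
Proof.
have dMn k p : dmul_d (p *+ k) = dmul_d p *+ k.
  elim: k => [|k IHk]; last by rewrite !mulrS dmul_dD IHk.
  by rewrite !mulr0n /dmul_d raddf0 mul0r addr0.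
elim: i => [|i IHi]; first by rewrite mulr0n addr0.
rewrite iterS deriv_dmul_d IHi dmul_dD -addrA; congr (_ + _).
rewrite dMn mulrSr; congr (_ + _).
by case: i {IHi} => [|i] //=; rewrite !mulr0n.
Qed.

Lemma diffop_formal_derivM P Q :
  diffop_formal_deriv (P * Q)
    = diffop_formal_deriv P * Q + P * diffop_formal_deriv Q.
Proof.
apply: dcoefs_inj => /=; set p := dcoefs P; set q := dcoefs Q.
rewrite (@dmul_widen (size p).-1 p^`()); last exact: size_poly.
rewrite /dmul raddf_sum /=.
under eq_bigr do rewrite derivZ deriv_iter_dmul_d scalerDr.
rewrite big_split /= addrC; congr (_ + _).
case: (size p) => [|N]; first by rewrite !big_ord0.
rewrite big_ord_recl /= mulr0n scaler0 add0r; apply: eq_bigr => i _ /=.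
by rewrite coef_deriv /bump add1n -scaler_nat scalerA mulr_natr.
Qed.

Lemma diffop_formal_deriv_coef r P j :
  diffop_coef j (iter r diffop_formal_deriv P)
    = diffop_coef (r + j) P *+ (r + j) ^_ r.
Proof.
rewrite /diffop_coef -coef_derivn.
suff -> : dcoefs (iter r diffop_formal_deriv P) = (dcoefs P)^`(r) by [].
by elim: r => //= r ->.
Qed.

(** The constant coefficient of [dz ^+ j * Q] is the [j]-th derivative of that of [Q]. Hence the
    recursion involves no [c_(i,k)] with [i > 0]. *)
Lemma diffop_coef0M P Q :
  diffop_coef 0 (P * Q) = \sum_(j < size (dcoefs P))
    diffop_coef j P * iter j (@zs_deriv A) (diffop_coef 0 Q).
Proof.
rewrite /diffop_coef /= coef_sum; apply: eq_bigr => j _; rewrite coefZ.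
congr (_ * _); elim: (j : nat) => //= i <-.
by rewrite coefD coefMX addr0 coef_map_id0 // raddf0.
Qed.

Lemma diffop_of_seriesM f g :
  diffop_of_series (f * g) = diffop_of_series f * diffop_of_series g.
Proof.
apply: dcoefs_inj; rewrite /= (@dmul_widen 1) ?size_polyC ?leq_b1 //.
by rewrite big_ord1 coefC /= polyCM mul_polyC.
Qed.

Fact diffop_of_series_zmod_morphism : zmod_morphism (@diffop_of_series A).
Proof. by move=> f g; apply: dcoefs_inj; rewrite /= polyCB. Qed.

HB.instance Definition _ := GRing.isZmodMorphism.Build _ _
  (@diffop_of_series A) diffop_of_series_zmod_morphism.

Lemma zcoefN f m : zcoef (- f) m = - zcoef f m.
Proof. by []. Qed.

Lemma zcoefMn f k m : zcoef (f *+ k) m = zcoef f m *+ k.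
Proof. by elim: k => [|k IHk]; rewrite ?zcoef0 // !mulrS zcoefD IHk. Qed.

Lemma zcoefM f g m :
  zcoef (f * g) m = \sum_(i < m.+1) zcoef f i * zcoef g (m - i).
Proof. by []. Qed.

End DiffOps.

(** * Manin relations and Newton recursion for d/dz - L(z) *)

Section LaxMatrix.
Variables (K : numFieldType) (n : nat).
Local Notation U := (uea (gl_current K n)).
Local Notation L := (lax_matrix K n).
Local Notation M := (dz_sub_lax K n).

Lemma current_gen_commutator (i j k l : 'I_n) r s :
  commutator (current_gen K i j r) (current_gen K k l s)
    = current_gen K i l (r + s) *+ (j == k)
      - current_gen K k j (r + s) *+ (l == i).
Proof.
rewrite /commutator -uea_gen_lie -!raddfMn -raddfB; congr uea_gen.
rewrite [LHS]/(gl_bracket _ _) /gl_bracket -!scalemxAl -!scalemxAr !scalerA.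
by rewrite !mul_delta_mx_cond -!exprD [(s + r)%N]addnC -!scalerMnr.
Qed.

(** For [z^-m] there are [m - 1] pairs of powers of [t] with sum [m - 2], all with the same bracket;
    differentiation in [z] produces the same factor, up to sign. *)
Lemma lax_commutator (i j k l : 'I_n) :
  commutator (L i j) (L k l)
    = zs_deriv (L k j) *+ (l == i) - zs_deriv (L i l) *+ (j == k).
Proof.
apply: zseriesP => m; rewrite /commutator !(zcoefD, zcoefN, zcoefMn) !zcoefM.
rewrite [X in _ - X](reindex_inj rev_ord_inj) -sumrB /= !mxE /=.
have cE (a : 'I_m.+1) : (m - (m - a) = a)%N.
  by have := ltn_ord a; lia.
under eq_bigr do rewrite subSS cE.
case: m {cE} => [|[|m]] /=.
- by rewrite big_ord1 /= !(mul0r, mulr0, mul0rn, oppr0, subr0, addr0).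
- rewrite big_ord_recl big_ord1 /=.
  by rewrite !(mul0r, mulr0, mul0rn, oppr0, subr0, addr0).
(* The two extreme terms vanish, as [L] has no coefficient of [z^0]. *)
rewrite big_ord_recl big_ord_recr /= subnn !mulr0 !mul0r !subr0 add0r addr0.
under eq_bigr => a _.
  rewrite /bump add1n !subSS subSn ?leq_ord //.
  rewrite -/(commutator _ _) current_gen_commutator subnKC ?leq_ord //.
  over.
rewrite sumr_const card_ord mulrnBl !mulNrn opprK [RHS]addrC -!mulrnA.
by rewrite ![(m.+1 * _)%N]mulnC.
Qed.

Lemma dz_sub_laxE i j :
  M i j = dz U *+ (i == j) - diffop_of_series (L i j).
Proof. by rewrite !mxE. Qed.

Lemma dz_sub_lax_commutator i j k l :
  commutator (M i j) (M k l)
    = diffop_of_series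
        (zs_deriv (L i j) *+ (k == l) - zs_deriv (L k l) *+ (i == j)
         + (zs_deriv (L k j) *+ (l == i) - zs_deriv (L i l) *+ (j == k))).
Proof.
rewrite -lax_commutator !dz_sub_laxE !(commutatorBl, commutatorBr).
have dzL (b : bool) f : commutator (dz U *+ b) (diffop_of_series f)
    = diffop_of_series (zs_deriv f *+ b).
  case: b; rewrite ?mulr1n ?mulr0n -?dz_commutator //.
  by rewrite /commutator mul0r mulr0 subrr raddf0.
have dzdz (a b : bool) : commutator (dz U *+ a) (dz U *+ b) = 0.
  by case: a b => [] []; rewrite /commutator ?mulr1n ?mulr0n ?mul0r ?mulr0
    subrr.
rewrite dzdz dzL [commutator _ (_ *+ _)]commutatorN dzL.
rewrite sub0r opprB opprK raddfD raddfB /= addrC -addrA [RHS]addrC.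
by congr (_ + _); rewrite /commutator raddfB /= !diffop_of_seriesM.
Qed.

(** Exchanging [i] and [k] swaps the contribution of [d/dz, L] with that of [L, L]. *)
Lemma manin_dz_sub_lax : manin M.
Proof.
move=> i j k l; rewrite !dz_sub_lax_commutator addrC.
by rewrite [k == j]eq_sym [l == k]eq_sym [j == i]eq_sym [i == l]eq_sym.
Qed.

Lemma formal_deriv_dz_sub_lax i j :
  diffop_formal_deriv (M i j) = (i == j)%:R.
Proof.
rewrite dz_sub_laxE raddfB raddfMn /=; apply: dcoefs_inj.
have -> : diffop_formal_deriv (dz U) = 1.
  by apply: dcoefs_inj; rewrite /= derivX.
by rewrite /= derivC subr0.
Qed.

(** Deriving [trace_alt M n] formally [r] times yields the factors 1, ..., [r]; dividing the falling
    factorial of the coefficients by [r!] leaves the binomial. *)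
Lemma coef_trace_alt r j : (r <= n)%N ->
  diffop_coef j (trace_alt M (n - r)) = QH K n (r + j) *+ 'C(r + j, r).
Proof.
have fact_iter : (r <= n)%N ->
    iter r (@diffop_formal_deriv U) (trace_alt M n)
      = trace_alt M (n - r) *+ r`!.
  elim: r => [|r IHr] rn; first by rewrite subn0 fact0.
  rewrite iterS IHr 1?ltnW // raddfMn.
  have -> : (n - r = (n - r.+1).+1)%N by lia.
  rewrite (@delta_trace_alt _ _ _ _ (@diffop_formal_deriv U)); last by lia.
  - by rewrite subKn // -mulrnA factS.
  - exact: diffop_formal_derivM.
  - exact: formal_deriv_dz_sub_lax.
move=> rn; have r_neq0 : r`!%:R != 0 :> K by rewrite pnatr_eq0 -lt0n fact_gt0.
apply: (scalerI r_neq0); rewrite !scaler_nat -raddfMn -fact_iter //.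
rewrite trace_alt_col_det; last exact: manin_dz_sub_lax.
by rewrite [LHS]diffop_formal_deriv_coef -mulrnA bin_ffact.
Qed.

Lemma diffop_coef1 j : diffop_coef j (1 : diffop U) = (j == 0%N)%:R.
Proof. by rewrite /diffop_coef coef1. Qed.

Lemma QH_n : QH K n n = 1.
Proof.
have := @coef_trace_alt n 0 (leqnn n).
by rewrite subnn trace_alt0 addn0 binn diffop_coef1.
Qed.

(** The higher coefficients of [trace_alt M 0 = 1] are nonzero binomial multiples of these [QH]. *)
Lemma QH_gt i : (n < i)%N -> QH K n i = 0.
Proof.
move=> ni; have := @coef_trace_alt n (i - n) (leqnn n).
rewrite subnn trace_alt0 diffop_coef1 subnKC 1?ltnW // subn_eq0 leqNgt ni.
move/eqP; rewrite eq_sym -scaler_nat scaler_eq0 pnatr_eq0 -leqn0 leqNgt.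
by rewrite bin_gt0 (ltnW ni) => /eqP.
Qed.

Lemma trace_sym0 : trace_sym M 0 = 1.
Proof.
rewrite trace_symE fact0 invr1 scale1r.
rewrite (big_pred1 [ffun a => widen_ord (leq0n n) a]); last first.
  by move=> f /=; apply/esym/eqP/ffunP => -[].
rewrite /sym_minor (big_pred1 1%g); last first.
  by move=> s /=; apply/esym/eqP/permP => -[].
by rewrite /word_prod big_ord0.
Qed.

Lemma newton_sym_coef k : (0 < k)%N ->
  \sum_(l < k.+1)
    (-1) ^+ l * diffop_coef 0 (trace_alt M l * trace_sym M (k - l)) = 0.
Proof.
move=> k0; rewrite -[RHS](raddf0 (diffop_coef 0)).
rewrite -(macmahon_manin manin_dz_sub_lax k0) raddf_sum; apply: eq_bigr => l _.
by rewrite raddfMsign.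
Qed.

End LaxMatrix.

(** * Solving the recursion *)

Section SeriesIn.
Variables (K : numFieldType) (A : lalgType K) (B : set A).
Hypothesis algB : GRing.subalg_closed [in B].
Implicit Types f g : zseries A.

Definition series_in f := forall m, B (zcoef f m).

Let BE x : (x \in [in B]) = B x :> Prop.
Proof. exact: in_setE. Qed.

Let B1 : B 1. Proof. by have [] := algB; rewrite BE. Qed.

Let BZD a x y : B x -> B y -> B (a *: x + y).
Proof. by have [_ BZ _] := algB; have := BZ a x y; rewrite !BE. Qed.

Let BM x y : B x -> B y -> B (x * y).
Proof. by have [_ _ BM] := algB; have := BM x y; rewrite !BE. Qed.

Let B0 : B 0. Proof. by rewrite -(addNr 1) -scaleN1r; apply: BZD. Qed.

Let BD x y : B x -> B y -> B (x + y).
Proof. by move=> Bx By; rewrite -[x]scale1r; apply: BZD. Qed.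

Let BN x : B x -> B (- x).
Proof. by move=> Bx; rewrite -[- x]addr0 -scaleN1r; apply: BZD. Qed.

Let BMn x k : B x -> B (x *+ k).
Proof. by move=> Bx; rewrite -[_ *+ _]addr0 -scaler_nat; apply: BZD. Qed.

Lemma series_in0 : series_in 0.
Proof. by move=> m; rewrite zcoef0. Qed.

Lemma series_in1 : series_in 1.
Proof. by case. Qed.

Lemma series_inN f : series_in f -> series_in (- f).
Proof. by move=> Bf m; apply: BN. Qed.

Lemma series_inD f g : series_in f -> series_in g -> series_in (f + g).
Proof. by move=> Bf Bg m; apply: BD. Qed.

Lemma series_inMn f k : series_in f -> series_in (f *+ k).
Proof. by move=> Bf m; rewrite zcoefMn; apply: BMn. Qed.

Lemma series_in_sum (I : Type) (r : seq I) (P : pred I) (F : I -> zseries A) :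
  (forall i, P i -> series_in (F i)) -> series_in (\sum_(i <- r | P i) F i).
Proof.
by move=> BF; elim/big_ind: _; [apply: series_in0|apply: series_inD|].
Qed.

Lemma series_inM f g : series_in f -> series_in g -> series_in (f * g).
Proof.
move=> Bf Bg m; rewrite zcoefM.
by elim/big_ind: _ => // i _; apply: BM.
Qed.

Lemma series_in_sign k f : series_in ((-1) ^+ k * f) <-> series_in f.
Proof.
rewrite -signr_odd mulr_sign; case: odd; split=> // Bf.
  by rewrite -[f]opprK; apply: series_inN.
exact: series_inN.
Qed.

Lemma series_in_deriv f : series_in f -> series_in (zs_deriv f).
Proof. by move=> Bf m; apply/BN/BMn. Qed.

Lemma series_in_diffop_coef0M (P Q : diffop A) :
    (forall j, series_in (diffop_coef j P)) -> series_in (diffop_coef 0 Q) ->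
  series_in (diffop_coef 0 (P * Q)).
Proof.
move=> BP BQ; rewrite diffop_coef0M; apply: series_in_sum => j _.
apply: series_inM => //; elim: (j : nat) => //= i.
exact: series_in_deriv.
Qed.

End SeriesIn.

Section Bethe.
Variables (K : numFieldType) (n : nat).
Local Notation U := (uea (gl_current K n)).
Local Notation M := (dz_sub_lax K n).
Variable B : set U.
Hypothesis algB : GRing.subalg_closed [in B].

(** Only the [QH] of index at least [n - l] enter [trace_alt M l]; this triangularity makes the
    recursion invertible. *)
Lemma series_in_coef_trace_alt l j :
    (forall i, (n - l <= i)%N -> series_in B (QH K n i)) ->
  series_in B (diffop_coef j (trace_alt M l)).
Proof.
move=> BQ; case: (leqP l n) => [ln|nl]; last first.
  by rewrite trace_alt_gt // raddf0; apply: (series_in0 algB).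
rewrite -[l in trace_alt _ l](subKn ln) coef_trace_alt ?leq_subr //.
by apply: (series_inMn algB) => //; apply: BQ; apply: leq_addr.
Qed.

(* In the recursion for k, the term l = 0 is c_(0,k), as A_0 = 1. *)
Lemma series_in_sym_coef :
    (forall i, (i <= n)%N -> series_in B (QH K n i)) ->
  forall k, series_in B (sym_coef K n 0 k).
Proof.
move=> BQ; elim/ltn_ind => -[|k] IHk.
  rewrite /sym_coef trace_sym0 -/(diffop_coef _ _) diffop_coef1.
  exact: (series_in1 algB).
have := newton_sym_coef K n (ltn0Sn k); rewrite big_ord_recl mul1r.
rewrite trace_alt0 mul1r subn0 => /eqP; rewrite addr_eq0 => /eqP.
rewrite -[diffop_coef 0 _]/(sym_coef K n 0 k.+1) => ->.
apply: (series_inN algB) => //; apply: (series_in_sum algB) => // l _.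
apply/(series_in_sign algB)/(series_in_diffop_coef0M algB).
  move=> j; apply: series_in_coef_trace_alt => i _.
  case: (leqP i n) => [/BQ //|ni]; rewrite QH_gt //; exact: (series_in0 algB).
by apply: IHk; rewrite /= /bump /=; lia.
Qed.

(* In the recursion for k, the term l = k is (-1)^k QH_(n-k), as H_0 = 1. *)
Lemma series_in_QH :
    (forall k, (1 <= k <= n)%N -> series_in B (sym_coef K n 0 k)) ->
  forall i, series_in B (QH K n i).
Proof.
move=> BS i; case: (leqP i n) => [|ni]; last first.
  by rewrite QH_gt //; exact: (series_in0 algB).
(* Induction on [k = n - i], descending from the leading coefficient [QH_n = 1]. *)
move=> /subKn <-; move: (n - i)%N (leq_subr i n) => {i} k.
elim/ltn_ind: k => -[|k] IHk kn.
  by rewrite subn0 QH_n; exact: (series_in1 algB).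
have := newton_sym_coef K n (ltn0Sn k).
rewrite big_ord_recr /= subnn trace_sym0 mulr1 => /eqP; rewrite addrC addr_eq0 => /eqP newton.
have <- : diffop_coef 0 (trace_alt M k.+1) = QH K n (n - k.+1).
  by rewrite -[in LHS](subKn kn) coef_trace_alt ?leq_subr // addn0 binn.
apply/(series_in_sign algB k.+1); rewrite newton.
apply: (series_inN algB) => //; apply: (series_in_sum algB) => // l _ /=.
have lk := ltn_ord l.
apply/(series_in_sign algB)/(series_in_diffop_coef0M algB).
  move=> j; apply: series_in_coef_trace_alt => i ni.
  case: (leqP i n) => [i_n|n_i]; last first.
    by rewrite QH_gt //; exact: (series_in0 algB).
  (* Here [n - i <= l < k.+1]. *)
  by rewrite -(subKn i_n); apply: IHk; lia.
(* The index [k.+1 - l] lies between 1 and [n], so the first [n] series suffice. *)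
by apply: BS; lia.
Qed.

End Bethe.

(** * Comparison of the generated subalgebras *)

Lemma generated_subalg_closed (K : nzRingType) (A : lalgType K) (G : set A) :
  GRing.subalg_closed [in generated_subalg G].
Proof.
split=> [|a x y|x y].
- by rewrite inE => B [[B1 _ _] _]; rewrite inE in B1.
- rewrite !inE => Gx Gy B GB; have [[_ /(_ a x y) BZ _] _] := GB.
  by rewrite !inE in BZ; apply: BZ; [apply: Gx|apply: Gy].
- rewrite !inE => Gx Gy B GB; have [[_ _ /(_ x y) BM] _] := GB.
  by rewrite !inE in BM; apply: BM; [apply: Gx|apply: Gy].
Qed.

Local Open Scope classical_set_scope.

Theorem corollary3 (R : realType) (n : nat) :
  (forall k : nat, (1 <= k)%N ->
     range (zcoef (sym_series (complex R) n k)) `<=` bethe (complex R) n)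
  /\ generated_subalg
       (\bigcup_(k in [set k : nat | (1 <= k <= n)%N])
          range (zcoef (sym_series (complex R) n k)))
     = bethe (complex R) n.
Proof.
have Salg k : series_in (bethe (complex R) n) (sym_series (complex R) n k).
  have alg := @generated_subalg_closed _ _
    (\bigcup_(i in `I_n.+1) range (zcoef (QH (complex R) n i))).
  apply: (proj2 (series_in_sign alg k _)).
  apply: (series_in_sym_coef alg) => i i_n m.
  by apply: sub_gen_smallest; exists i => //; exists m.
split=> [k _ _ [m _ <-]|]; first exact: Salg.
apply/seteqP; split.
  apply: smallest_sub; first exact: generated_subalg_closed.
  by move=> _ [k _ [m _ <-]]; apply: Salg.
(* Conversely, the subalgebra generated by the first [n] series contains the coefficients of every
   [QH_i]. *)
have alg := @generated_subalg_closed _ _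
  (\bigcup_(k in [set k | (1 <= k <= n)%N])
     range (zcoef (sym_series (complex R) n k))).
apply: smallest_sub => // _ [i _ [m _ <-]].
apply: (series_in_QH alg) => k kn.
apply: (proj1 (series_in_sign alg k _)) => {}m.
by apply: sub_gen_smallest; exists k => //; exists m.
Qed.
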